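(* (i) If $\alpha>0$ then $\lambda_1(\mathcal{B};\alpha)$ is positive and is minimal for the cube and only the cube, among rectangular boxes $\mathcal{B} \subset \mathbb{R}^n$ of given volume. (ii) If $\alpha<0$ then $\lambda_1(\mathcal{B};\alpha)$ is negative and is maximal for the cube and only the cube, among rectangular boxes $\mathcal{B} \subset \mathbb{R}^n$ of given volume.
   Context: A rectangular box in $\mathbb{R}^n$ is (up to rotation) a Cartesian product of $n$ bounded nonempty open intervals; a cube is a box whose edges all have the same length. For a bounded Lipschitz domain $\Omega \subset \mathbb{R}^n$ and $\alpha \in \mathbb{R}$, $\lambda_1(\Omega;\alpha)$ denotes the first eigenvalue of the Robin problem $-\Delta u = \lambda u$ in $\Omega$, $\partial u/\partial \nu + \alpha u = 0$ on $\partial \Omega$ ($\nu$ the outward unit normal). Equivalently $$\lambda_1(\Omega;\alpha) = \min_{u \in H^1(\Omega)\setminus\{0\}} \frac{\int_\Omega |\nabla u|^2\,dx + \alpha \int_{\partial\Omega} u^2\,dS}{\int_\Omega u^2\,dx}.$$ *)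

(* Defs.v *)
From HB Require Import structures.
From mathcomp Require Import all_boot all_order all_algebra.
From mathcomp Require Import all_classical all_reals all_analysis.
Import Order.TTheory GRing.Theory Num.Theory.
Import numFieldNormedType.Exports.

Set Implicit Arguments.
Unset Strict Implicit.
Unset Printing Implicit Defensive.

Local Open Scope classical_set_scope.
Local Open Scope ring_scope.

Definition measure_rV_display : measure_display.
Proof. exact: (measure_tuple_display default_measure_display). Qed.

(* The Borel sigma-algebra of R^n, generated by the coordinate functions. *)
Section measurable_rV.
Context {R : realType} (n : nat).

Definition rV_coord (i : 'I_n) (x : 'rV[R]_n) : measurableTypeR R := x ord0 i.

Let rV_set0 : g_sigma_preimage rV_coord set0.
Proof. exact: sigma_algebra0. Qed.

Let rV_setC A : g_sigma_preimage rV_coord A -> g_sigma_preimage rV_coord (~` A).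
Proof. exact: sigma_algebraC. Qed.

Let rV_bigcup (F : (set 'rV[R]_n)^nat) :
  (forall i, g_sigma_preimage rV_coord (F i)) ->
  g_sigma_preimage rV_coord (\bigcup_i (F i)).
Proof. exact: sigma_algebra_bigcup. Qed.

HB.instance Definition _ := @isMeasurable.Build measure_rV_display
  'rV[R]_n (g_sigma_preimage rV_coord) rV_set0 rV_setC rV_bigcup.

Lemma measurable_rV_coord (i : 'I_n) : measurable_fun [set: 'rV[R]_n] (rV_coord i).
Proof.
move=> _ Y mY; rewrite setTI; apply: sub_sigma_algebra => /=.
rewrite -bigcup_seq/=; exists i => /=; first by rewrite mem_index_enum.
by exists Y => //; rewrite setTI.
Qed.

Lemma measurable_fun_rV d (T : measurableType d) (f : T -> 'rV[R]_n) :
  (forall i, measurable_fun [set: T] (rV_coord i \o f)) ->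
  measurable_fun [set: T] f.
Proof.
move=> mf _ A mA; rewrite setTI.
suff : image_set_system setT f measurable A by rewrite /image_set_system/= setTI.
apply: mA; split => [|B]; first exact/sigma_algebra_image/sigma_algebra_measurable.
rewrite /= -bigcup_seq => -[i _ [C mC <-]].
rewrite /image_set_system/= !setTI -comp_preimage -[X in measurable X]setTI.
exact: mf.
Qed.

End measurable_rV.

Section rV_cons.
Context {R : realType} (n : nat).

Definition rV_cons (p : measurableTypeR R * 'rV[R]_n) : 'rV[R]_n.+1 :=
  row_mx (p.1%:M : 'rV[R]_1) p.2.

Definition rV_uncons (x : 'rV[R]_n.+1) : measurableTypeR R * 'rV[R]_n :=
  (x ord0 ord0, \row_i x ord0 (lift ord0 i)).

Lemma rV_cons0 p : rV_coord ord0 (rV_cons p) = p.1.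
Proof.
by rewrite /rV_coord mxE; case: splitP => // j _; rewrite [j]ord1 mxE.
Qed.

Lemma rV_consS p i : rV_coord (lift ord0 i) (rV_cons p) = rV_coord i p.2.
Proof.
rewrite /rV_coord mxE; case: splitP => [[[]]//|j ij].
by congr (p.2 _ _); apply/val_inj; case: ij.
Qed.

Lemma rV_consK : cancel rV_cons rV_uncons.
Proof.
move=> [a y]; congr pair; first exact: (rV_cons0 (a, y)).
by apply/rowP => i; rewrite mxE; exact: (rV_consS (a, y)).
Qed.

Lemma measurable_rV_cons : measurable_fun setT rV_cons.
Proof.
apply: measurable_fun_rV => i; case: (unliftP ord0 i) => [j|] ->.
  rewrite (_ : _ \o _ = rV_coord j \o snd); last first.
    by apply/funext => p; exact: rV_consS.
  by apply: measurableT_comp; [exact: measurable_rV_coord|exact: measurable_snd].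
rewrite (_ : _ \o _ = fst); first exact: measurable_fst.
by apply/funext => p; exact: rV_cons0.
Qed.

Lemma measurable_rV_uncons : measurable_fun setT rV_uncons.
Proof.
apply/measurable_fun_pairP; split; first exact: (measurable_rV_coord ord0).
apply: measurable_fun_rV => i.
rewrite (_ : _ \o _ = rV_coord (lift ord0 i)); first exact: measurable_rV_coord.
by apply/funext => x; rewrite /rV_coord /= mxE.
Qed.

Variable mu : {sigma_finite_measure set 'rV[R]_n -> \bar R}.

Definition lebesgue_cons : set 'rV[R]_n.+1 -> \bar R :=
  pushforward (lebesgue_measure \x mu)%E rV_cons.

Let lebesgue_cons0 : lebesgue_cons set0 = 0%E.
Proof. by rewrite /lebesgue_cons /pushforward preimage_set0 measure0. Qed.

Let lebesgue_cons_ge0 A : (0 <= lebesgue_cons A)%E.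
Proof. exact: (measure_ge0 (lebesgue_measure \x mu)%E). Qed.

Let lebesgue_cons_sigma_additive : semi_sigma_additive lebesgue_cons.
Proof.
move=> F mF tF mUF; rewrite /lebesgue_cons /pushforward preimage_bigcup.
have mpre A : measurable A -> measurable (rV_cons @^-1` A).
  by move=> mA; rewrite -[X in measurable X]setTI; exact: measurable_rV_cons.
apply: (@measure_semi_sigma_additive _ _ _ (lebesgue_measure \x mu)%E).
- by move=> k; exact: mpre.
- apply/trivIsetP => /= i j _ _ ij; rewrite -preimage_setI.
  by move/trivIsetP : tF => /(_ _ _ _ _ ij) ->//; rewrite preimage_set0.
- by rewrite -preimage_bigcup; exact: mpre.
Qed.

HB.instance Definition _ := isMeasure.Build _ _ _ lebesgue_cons
  lebesgue_cons0 lebesgue_cons_ge0 lebesgue_cons_sigma_additive.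

Let lebesgue_cons_sigma_finite : sigma_finite setT lebesgue_cons.
Proof.
have /sigma_finiteP[F [TF ndF Foo]] := sigma_finiteT (@lebesgue_measure R).
have /sigma_finiteP[G [TG ndG Goo]] := sigma_finiteT mu.
exists (fun k => rV_uncons @^-1` (F k `*` G k)).
  rewrite -preimage_bigcup -[LHS](preimage_setT rV_uncons); congr (_ @^-1` _).
  rewrite -setXTT TF TG predeqE => -[x y]; split.
    move=> [/= [k _ Fkx] [l _ Gly]]; exists (maxn k l) => //; split.
    - by move: x Fkx; exact/subsetPset/ndF/leq_maxl.
    - by move: y Gly; exact/subsetPset/ndG/leq_maxr.
  by move=> [k _ []/= ? ?]; split; exists k.
move=> k; have [mF Fkoo] := Foo k; have [mG Gkoo] := Goo k; split.
  rewrite -[X in measurable X]setTI; apply: measurable_rV_uncons => //.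
  exact: measurableX.
rewrite /lebesgue_cons /pushforward -comp_preimage.
rewrite (_ : _ \o _ = id); last by apply/funext => p; exact: rV_consK.
by rewrite preimage_id product_measure1E// lte_mul_pinfty// ge0_fin_numE.
Qed.

HB.instance Definition _ := Measure_isSigmaFinite.Build _ _ _ lebesgue_cons
  lebesgue_cons_sigma_finite.

End rV_cons.

(* n-dimensional Lebesgue measure, as the n-fold product of lebesgue_measure;
   on R^0 it is the unit mass, so that it is counting measure on points. *)
Fixpoint lebesgue_rV {R : realType} (n : nat) :
    {sigma_finite_measure set 'rV[R]_n -> \bar R} :=
  match n with
  | 0 => \d_(0 : 'rV[R]_0)
  | m.+1 => lebesgue_cons (lebesgue_rV m)
  end.

Section sobolev.
Context {R : realType} (n : nat).
Implicit Types (Om : set 'rV[R]_n) (f u phi : 'rV[R]_n -> R)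
  (g : 'I_n -> 'rV[R]_n -> R).

Definition partial (i : 'I_n) f : 'rV[R]_n -> R :=
  fun x => 'D_(delta_mx ord0 i) f x.

Definition C1 f : Prop :=
  (forall x, differentiable f x) /\ forall i, continuous (partial i f).

Definition L2sq Om f : \bar R := (\int[lebesgue_rV n]_(x in Om) ((f x) ^+ 2)%:E)%E.

Definition in_L2 Om f : Prop :=
  measurable_fun Om f /\ (L2sq Om f < +oo)%E.

Definition test_function Om phi : Prop :=
  C1 phi /\
  exists K : set 'rV[R]_n,
    [/\ compact K, K `<=` Om & forall x, ~ K x -> phi x = 0].

Definition weak_gradient Om u g : Prop :=
  forall (i : 'I_n) phi, test_function Om phi ->
    \int[lebesgue_rV n]_(x in Om) (u x * partial i phi x) =
    - \int[lebesgue_rV n]_(x in Om) (g i x * phi x).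

(* u belongs to H^1(Om) and g is its gradient. *)
Definition in_H1 Om u g : Prop :=
  [/\ in_L2 Om u, forall i, in_L2 Om (g i) & weak_gradient Om u g].

End sobolev.

(* The box consists of the points y *m box_frame with
   box_lo 0 i < y 0 i < box_hi 0 i for all i: the rows of the rotation matrix
   box_frame are the directions of the edges. *)
Record box (R : realType) (n : nat) := Box {
  box_frame : 'M[R]_n;
  box_lo : 'rV[R]_n;
  box_hi : 'rV[R]_n;
  box_frame_orth : box_frame *m box_frame^T = 1%:M;
  box_frame_det : \det box_frame = 1;
  box_lo_lt_hi : forall i, box_lo ord0 i < box_hi ord0 i }.

Section open_box.
Context {R : realType}.

Definition open_box m (lo hi : 'rV[R]_m) : set 'rV[R]_m :=
  [set y | forall i, lo ord0 i < y ord0 i < hi ord0 i].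

Context (n : nat).
Implicit Types B : box R n.

Definition box_set B : set 'rV[R]_n :=
  [set y *m box_frame B | y in open_box (box_lo B) (box_hi B)].

Definition volume B : \bar R := lebesgue_rV n (box_set B).

Definition edge B (i : 'I_n) : R := box_hi B ord0 i - box_lo B ord0 i.

Definition is_cube B : Prop := forall i j, edge B i = edge B j.

(* For each j, the box has two faces orthogonal to the j-th edge direction.
   face_point B j s is an isometric parametrization of the hyperplane
   containing one of them, and the face itself is the image of face_dom B j. *)
Definition face_dom B (j : 'I_n) : set 'rV[R]_n.-1 :=
  open_box (col' j (box_lo B)) (col' j (box_hi B)).

Definition face_point B (j : 'I_n) (s : bool) (z : 'rV[R]_n.-1) : 'rV[R]_n :=
  (\row_i if unlift j i is Some k then z ord0 k
          else (if s then box_hi B else box_lo B) ord0 j) *m box_frame B.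

(* The integral of f over the boundary of B with respect to surface measure;
   the edges where faces meet form a null set. *)
Definition boundary_integral B (f : 'rV[R]_n -> \bar R) : \bar R :=
  (\sum_(j < n) \sum_(s : bool)
    \int[lebesgue_rV n.-1]_(z in face_dom B j) f (face_point B j s z))%E.

Definition bdryL2sq B (t : 'rV[R]_n -> R) : \bar R :=
  boundary_integral B (fun x => ((t x) ^+ 2)%:E).

(* t is the boundary trace of the function u with gradient g: the trace operator
   is the continuous extension to H^1(B) of the restriction map
   u |-> u|_(boundary of B) defined for functions of class C^1 up to the
   boundary, that is, restrictions of C^1 functions on R^n. *)
Definition is_trace B (u : 'rV[R]_n -> R) (g : 'I_n -> 'rV[R]_n -> R)
    (t : 'rV[R]_n -> R) : Prop :=
  [/\ measurable_fun setT t, (bdryL2sq B t < +oo)%E &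
   exists v : nat -> 'rV[R]_n -> R,
    [/\ forall k, C1 (v k),
        L2sq (box_set B) (fun x => v k x - u x) @[k --> \oo] --> 0%E,
        forall i, L2sq (box_set B) (fun x => partial i (v k) x - g i x)
          @[k --> \oo] --> 0%E &
        bdryL2sq B (fun x => v k x - t x) @[k --> \oo] --> 0%E]].

Definition robin_quotient B (alpha : R) (u : 'rV[R]_n -> R)
    (g : 'I_n -> 'rV[R]_n -> R) (t : 'rV[R]_n -> R) : R :=
  (\int[lebesgue_rV n]_(x in box_set B) (\sum_(i < n) g i x ^+ 2)
   + alpha * fine (bdryL2sq B t)) / fine (L2sq (box_set B) u).

Definition robin_quotients B (alpha : R) : set R :=
  [set q | exists u g t,
    [/\ in_H1 (box_set B) u g, L2sq (box_set B) u != 0%E, is_trace B u g t &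
        q = robin_quotient B alpha u g t]].

(* The first Robin eigenvalue, as the minimum of the Rayleigh quotient over
   the nonzero elements of H^1(B); the default value 0 would only be taken if
   this minimum were not attained. *)
Definition lambda1 B (alpha : R) : R :=
  xget 0 [set l | robin_quotients B alpha l /\
                  lbound (robin_quotients B alpha) l].

End open_box.

(* Main.v *)
From HB Require Import structures.
Require Import Defs.
From mathcomp Require Import all_boot all_order all_fingroup all_algebra.
From mathcomp Require Import all_classical all_reals all_analysis.
From mathcomp Require Import measurable_realfun ring lra.
Import Order.TTheory GRing.Theory Num.Theory.
Import numFieldNormedType.Exports.
Set Implicit Arguments.
Unset Strict Implicit.
Unset Printing Implicit Defensive.
Local Open Scope classical_set_scope.
Local Open Scope ring_scope.

(** The first Robin eigenvalue of a box is a sum over its edges. Let [phi] be the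
    positive mode of an interval as long as the [j]-th edge: [- phi'' = lam phi]
    with [phi' = alpha phi] at the left end and [phi' = - alpha phi] at the right
    end. Its logarithmic derivative [w = phi' / phi] solves the Riccati equation
    [w' = - lam - w ^ 2], so that every function [f] of class C1 satisfies

      (d_j f) ^ 2 - lam f ^ 2 - d_j (w f ^ 2) = (d_j f - w f) ^ 2.

    After integration over the box the divergence theorem turns the third term
    into the boundary terms of the two faces orthogonal to the [j]-th edge, with
    the right coefficient [alpha] ([coordinate_energy_identity]). Summed over the
    edges, the Robin energy of [f] minus [sum_j lam_j] times its squared L2 norm is
    an integral of squares ([box_energy_identity]). It is therefore nonnegative,
    for [f] in H^1 by passing to the limit, since a trace is by definition a limit
    of restrictions of C1 functions ([H1_robin_bound]); and it vanishes when [f] is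
    the product of the modes. The minimum is thus [sum_j lam_j] ([lambda1_box]).

    Lebesgue measure being built as an iterated product, one must also know that
    it is invariant under rotations. This follows from its invariance under
    translations: Tonelli's theorem compares the measure and its image under an
    orthogonal map up to a constant ([lebesgue_rV_linear]), and a ball, which is
    invariant, shows that the constant is 1 ([lebesgue_rV_orth]).

    It remains to study one interval. With [sigma] the sign of [alpha], the
    eigenvalue [lam] and the length [l] are parametrized by a number [x > 0],

      sigma lam = alpha ^ 2 / x ^ 2,    |alpha| l / 2 = x E(x),

    where [E] is [atan] if [sigma = 1] and the inverse hyperbolic tangent if
    [sigma = - 1]; in both cases [E' = 1 / (1 + sigma x ^ 2)]. Regarded as a
    function of [ln l], the quantity [sigma lam] has slope proportional to
    [- 1 / slope_ratio x], where [slope_ratio] is strictly increasing; hence it lies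
    strictly above its tangent lines ([tangent_log]). For boxes of given volume the
    sum of the [ln l_j] is fixed, so summing the tangent line inequality at the
    edge of the cube over all edges cancels the linear terms: [sigma lambda1] is
    minimal for the cube, and only for it ([cube_strict_min]). *)

(** * Borel sets and measurable maps of row vectors *)

Section borel_row_vectors.
Context {R : realType}.

Lemma row_ball n (x : 'rV[R]_n) r y : 0 < r ->
  ball x r y <-> forall i, `|x ord0 i - y ord0 i| < r.
Proof.
move=> r0; split=> [[_ xy] i|xy]; first exact: (xy ord0 i).
by split=> // i j; rewrite [i]ord1; exact: xy.
Qed.

(** The norm of row vectors is the maximum norm, so its balls are products of
    intervals, and an open set is a countable union of balls with rational centre
    and radius. *)
Lemma open_measurable_rV n (U : set 'rV[R]_n) : open U -> measurable U.
Proof.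
move=> oU.
pose q2r (q : 'rV[rat]_n) : 'rV[R]_n := map_mx ratr q.
pose B (p : 'rV[rat]_n * nat) : set 'rV[R]_n := ball (q2r p.1) p.2.+1%:R^-1.
have mB p : measurable (B p).
  have -> : B p = \big[setI/setT]_(i < n)
      ((rV_coord i) @^-1` (ball (q2r p.1 ord0 i) p.2.+1%:R^-1)).
    apply/seteqP; split=> [y|y].
      move=> /row_ball H; rewrite -bigcap_seq => i _ /=.
      by apply: H; rewrite invr_gt0.
    rewrite -bigcap_seq => H; apply/row_ball; first by rewrite invr_gt0.
    by move=> i; apply: (H i) => /=; rewrite mem_index_enum.
  apply: bigsetI_measurable => i _; rewrite -[X in measurable X]setTI.
  by apply: measurable_rV_coord => //; exact: measurable_realfun.measurable_ball.
pose F p := if `[< B p `<=` U >] then B p else set0.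
suff -> : U = \bigcup_p F p.
  apply: countable_bigcupT_measurable => // p.
  by rewrite /F; case: ifP.
apply/seteqP; split=> [x Ux|x [p _]]; last first.
  by rewrite /F; case: asboolP => // BU; exact: BU.
have /nbhs_ballP[e /= e0 xe] := open_nbhs_nbhs (conj oU Ux).
have [k ke] : exists k : nat, k.+1%:R^-1 < e / 2.
  by have [k _ /(_ k (leqnn k))] := near_infty_natSinv_lt (PosNum (divr_gt0 e0 (ltr0n _ 2))); exists k.
have k0 : 0 < k.+1%:R^-1 :> R by rewrite invr_gt0.
have H i : {q : rat | `|ratr q - x ord0 i| < k.+1%:R^-1}.
  apply: cid.
  move: k0; set d := _^-1 => d0.
  have [|q] := @rat_in_itvoo _ (x ord0 i - d) (x ord0 i + d).
    by lra.
  by rewrite in_itv/= => Hq; exists q; rewrite ltr_norml; lra.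
exists (\row_i projT1 (H i), k) => //.
have Bx : B (\row_i projT1 (H i), k) x.
  by apply/row_ball => // i; rewrite !mxE; exact: (projT2 (H i)).
rewrite /F; case: asboolP => // -[] y /= Hy; apply: xe.
apply/row_ball => // i.
move/row_ball: Hy => /(_ k0 i) /=; move/row_ball : Bx => /(_ k0 i) /=.
set a := q2r _ _ _; move: ke; set d := _^-1 => ke.
by rewrite !ltr_norml; lra.
Qed.

Lemma continuous_measurable_rV n (U : set 'rV[R]_n) (f : 'rV[R]_n -> R) :
  open U -> {in U, continuous f} -> measurable_fun U f.
Proof.
move=> oU cf; apply: (measurability _ (RGenOpens.measurableE R)).
move=> _ [_ [a [b ->] <-]].
apply: open_measurable_rV.
have -> : U `&` f @^-1` `]a, b[%classic = U `&` (U `&` f @^-1` `]a, b[%classic)°.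
  apply/seteqP; split=> [x [Ux fx]|x [Ux /interior_subset[]//]].
  split => //; apply: filterI; first exact: open_nbhs_nbhs.
  apply: (cf x); first by rewrite inE.
  by apply: open_nbhs_nbhs; split => //; exact: interval_open.
by apply: openI => //; exact: open_interior.
Qed.

Lemma measurable_mulmx m n (M : 'M[R]_(m, n)) :
  measurable_fun [set: 'rV[R]_m] (fun x : 'rV[R]_m => x *m M).
Proof.
apply: measurable_fun_rV => i.
have -> : rV_coord i \o (fun x : 'rV[R]_m => x *m M) =
    (fun x => \sum_(j < m) (rV_coord j x * M j i)).
  by apply/funext => x; rewrite /rV_coord/= mxE.
apply: measurable_sum => j; apply: measurable_funM => //.
exact: measurable_rV_coord.
Qed.

Lemma measurable_addrV n :
  measurable_fun [set: 'rV[R]_n * 'rV[R]_n] (fun p => p.1 + p.2).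
Proof.
apply: measurable_fun_rV => i.
have -> : rV_coord i \o (fun p : 'rV[R]_n * 'rV[R]_n => p.1 + p.2) =
    (rV_coord i \o fst) \+ (rV_coord i \o snd).
  by apply/funext => x; rewrite /rV_coord/= mxE.
by apply: measurable_funD; apply: measurableT_comp => //;
  exact: measurable_rV_coord.
Qed.

Lemma measurable_translate n (a : 'rV[R]_n) :
  measurable_fun [set: 'rV[R]_n] (fun x => x + a).
Proof.
exact: (measurable_fun_pair1 a (@measurable_addrV n)).
Qed.

End borel_row_vectors.

(** * Translation invariance of Lebesgue measure *)

Section invariance.
Context {R : realType}.

Lemma lebesgue_measure_translate (a : R) (A : set (measurableTypeR R)) :
  measurable A -> lebesgue_measure ((+%R^~ a) @^-1` A) = lebesgue_measure A.
Proof.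
move=> mA.
have mf : measurable_fun [set: measurableTypeR R] ((+%R^~ a) : _ -> measurableTypeR R).
  exact: measurable_funD.
pose mf_mixin := isMeasurableFun.Build _ _ _ _ _ mf.
pose f : {mfun measurableTypeR R >-> measurableTypeR R} :=
  HB.pack ((+%R^~ a) : _ -> measurableTypeR R) mf_mixin.
apply/esym/(@lebesgue_measure_unique _ (pushforward lebesgue_measure f)) => //.
move=> _ [[b c] _ <-]; rewrite /pushforward/=.
rewrite [X in _ = lebesgue_measure X](_ : _ = `](b - a), (c - a)]%classic); last first.
  by apply/seteqP; split => x /=; rewrite !in_itv/= ltrBlDr lerBrDr.
rewrite !lebesgue_measure_itv/= !lte_fin ltrD2r.
by case: ifPn => // _; rewrite -!EFinB; congr EFin; ring.
Qed.

Lemma measurable_preimageT d d' (T : measurableType d) (T' : measurableType d')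
    (f : T -> T') A : measurable_fun setT f -> measurable A ->
  measurable (f @^-1` A).
Proof. by move=> mf mA; rewrite -[X in measurable X]setTI; exact: mf. Qed.


(** The image of the product measure takes the same values on rectangles, and
    these values characterize the product measure. *)
Lemma product_measure_preserving d1 d2 (T1 : measurableType d1)
    (T2 : measurableType d2) (m1 : {sigma_finite_measure set T1 -> \bar R})
    (m2 : {sigma_finite_measure set T2 -> \bar R}) (f1 : T1 -> T1) (f2 : T2 -> T2) :
  measurable_fun setT f1 -> measurable_fun setT f2 ->
  (forall A, measurable A -> m1 (f1 @^-1` A) = m1 A) ->
  (forall A, measurable A -> m2 (f2 @^-1` A) = m2 A) ->
  forall A, measurable A ->
    (m1 \x m2)%E ((fun p => (f1 p.1, f2 p.2)) @^-1` A) = (m1 \x m2)%E A.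
Proof.
move=> mf1 mf2 f1m f2m A mA.
have mf : measurable_fun setT (fun p : T1 * T2 => (f1 p.1, f2 p.2)).
  by apply: measurable_fun_pair; exact: measurableT_comp.
pose mf_mixin := isMeasurableFun.Build _ _ _ _ _ mf.
pose T12 : measurableType _ := (T1 * T2)%type.
pose f : {mfun T12 >-> T12} := HB.pack (fun p : T1 * T2 => (f1 p.1, f2 p.2)) mf_mixin.
apply/esym/(@product_measure_unique _ _ _ _ _ _ _ (pushforward (m1 \x m2)%E f)) => //.
move=> X Y mX mY; rewrite /pushforward/=.
rewrite [X in (m1 \x m2)%E X = _](_ : _ = (f1 @^-1` X) `*` (f2 @^-1` Y)); last by apply/seteqP; split.
rewrite (product_measure1E _ _ (measurable_preimageT mf1 mX) (measurable_preimageT mf2 mY)).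
by congr (_ * _)%E; [exact: f1m|exact: f2m].
Qed.

Lemma lebesgue_rVS n (A : set 'rV[R]_n.+1) :
  lebesgue_rV n.+1 A =
  (lebesgue_measure \x lebesgue_rV n)%E (@rV_cons R n @^-1` A).
Proof. by []. Qed.

Lemma measurable_preimage_rV_cons n (A : set 'rV[R]_n.+1) : measurable A ->
  measurable (@rV_cons R n @^-1` A).
Proof.
by move=> mA; rewrite -[X in measurable X]setTI; exact: measurable_rV_cons.
Qed.

Lemma lebesgue_rV_translate n (a : 'rV[R]_n) A : measurable A ->
  lebesgue_rV n ((fun x => x + a) @^-1` A) = lebesgue_rV n A.
Proof.
elim: n a A => [|n IH] a A mA.
  congr (lebesgue_rV 0 _); apply/seteqP; split => x /=;
    by rewrite [a]thinmx0 addr0.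
rewrite !lebesgue_rVS.
pose b := rV_uncons a.
have E (p : measurableTypeR R * 'rV[R]_n) :
    rV_cons p + a = rV_cons (p.1 + b.1 : measurableTypeR R, p.2 + b.2).
  apply/rowP => i; rewrite [LHS]mxE; case: (unliftP ord0 i) => [j|] ->.
    by rewrite -!/(rV_coord _ (rV_cons _)) !rV_consS /rV_coord !mxE.
  by rewrite -!/(rV_coord _ (rV_cons _)) !rV_cons0.
rewrite [X in (_ \x _)%E X](_ : _ =
   (fun p : measurableTypeR R * 'rV[R]_n => (p.1 + b.1 : measurableTypeR R, p.2 + b.2)) @^-1`
     (@rV_cons R n @^-1` A)); last first.
  by apply/seteqP; split => p /=; rewrite E.
have mA' := measurable_preimage_rV_cons mA.
apply: (@product_measure_preserving _ _ _ _ lebesgue_measure (lebesgue_rV n)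
  (fun s => s + b.1 : measurableTypeR R) (fun x => x + b.2)) => //.
- exact: measurable_funD.
- exact: measurable_translate.
- by move=> B; exact: lebesgue_measure_translate.
- by move=> B; exact: IH.
Qed.

(** Both sides are the measure, computed by Tonelli's theorem, of the set of the
    pairs [(x, y)] with [x M] in [A] and [x M + y] in [G]. Integrating in [y] first
    gives the left side, as the condition on [y] is a translate of [G]; translating
    [x] by [y M^-1] before integrating in [y] gives the right side. *)
Lemma lebesgue_rV_linear n (M N : 'M[R]_n) A G : N *m M = 1%:M ->
  measurable A -> measurable G ->
  (lebesgue_rV n ((fun x => x *m M) @^-1` A) * lebesgue_rV n G =
   lebesgue_rV n ((fun x => x *m M) @^-1` G) * lebesgue_rV n (-%R @^-1` A))%E.
Proof.
move=> NM mA mG; set nu := lebesgue_rV n.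
have mN : measurable_fun setT (-%R : 'rV[R]_n -> 'rV[R]_n).
  have -> : (-%R : 'rV[R]_n -> 'rV[R]_n) = (fun x => x *m (- 1%:M)).
    by apply/funext => x; rewrite mulmxN mulmx1.
  exact: measurable_mulmx.
have mM := @measurable_mulmx R n n M.
have mD := @measurable_addrV R n.
have mfM : measurable_fun setT (fun p : 'rV[R]_n * 'rV[R]_n => p.1 *m M).
  exact: (measurableT_comp mM measurable_fst).
have mh : measurable_fun setT (fun p : 'rV[R]_n * 'rV[R]_n => p.1 *m M + p.2).
  exact: (measurableT_comp mD (measurable_fun_pair mfM measurable_snd)).
have mk : measurable_fun setT (fun p : 'rV[R]_n * 'rV[R]_n => p.1 *m M - p.2).
  exact: (measurableT_comp mD (measurable_fun_pair mfM
    (measurableT_comp mN measurable_snd))).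
pose S1 := [set p : 'rV[R]_n * 'rV[R]_n | A (p.1 *m M) /\ G (p.1 *m M + p.2)].
pose S2 := [set p : 'rV[R]_n * 'rV[R]_n | G (p.1 *m M) /\ A (p.1 *m M - p.2)].
have mS1 : measurable S1.
  by apply: (@measurableI _ _ (_ @^-1` A) (_ @^-1` G)); exact: measurable_preimageT.
have mS2 : measurable S2.
  by apply: (@measurableI _ _ (_ @^-1` G) (_ @^-1` A)); exact: measurable_preimageT.
have swap S : measurable S -> (nu \x nu)%E S = (nu \x^ nu)%E S.
  move=> mS; apply: product_measure_unique => // X Y mX mY.
  by rewrite [LHS]product_measure2E.
have E (B C : set 'rV[R]_n) (S : set ('rV[R]_n * 'rV[R]_n)) (r : \bar R) :
    measurable B -> (0 <= r)%E ->
    (forall x, B (x *m M) -> nu (xsection S x) = r) ->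
    (forall x y, S (x, y) -> B (x *m M)) ->
    (nu \x nu)%E S = (nu ((fun x => x *m M) @^-1` B) * r)%E.
  move=> mB r0 HB SB.
  have mMB := measurable_preimageT mM mB.
  rewrite [LHS](_ : _ = (\int[nu]_x (r * (\1_((fun x => x *m M) @^-1` B) x)%:E))%E).
    rewrite ge0_integralZl// ?integral_indic ?setIT//; first by rewrite muleC.
    exact/measurable_EFinP/measurable_indic.
  apply: eq_integral => x _ /=; rewrite indicE.
  have [xB|xB] := pselect (B (x *m M)).
    by rewrite mem_set// mule1 HB.
  rewrite memNset// mule0 -[RHS](measure0 nu); congr (nu _).
  by apply/seteqP; split => y // /xsectionP /SB.
have E1 : (nu \x nu)%E S1 = (nu ((fun x => x *m M) @^-1` A) * nu G)%E.
  apply: E => // [x xA|x y []//].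
  rewrite -[RHS](lebesgue_rV_translate (x *m M))//.
  congr (nu _); apply/seteqP; split => y /=.
    by move=> /xsectionP[_ /=]; rewrite addrC.
  by rewrite addrC => yG; apply/xsectionP.
have E2 : (nu \x nu)%E S2 = (nu ((fun x => x *m M) @^-1` G) * nu (-%R @^-1` A))%E.
  have mNA := measurable_preimageT mN mA.
  apply: E => // [x xG|x y []//].
  rewrite -[RHS](lebesgue_rV_translate (- (x *m M)) mNA)//.
  congr (nu _); apply/seteqP; split => y /=.
    by move=> /xsectionP[_ /=]; rewrite opprB.
  by rewrite opprB => yA; apply/xsectionP.
rewrite -E1 -E2 !swap//.
apply: eq_integral => y _ /=.
rewrite -[LHS](lebesgue_rV_translate (- (y *m N))); last exact: measurable_ysection.
congr (nu _); apply/seteqP; split => x /=.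
  move/ysectionP => -[]; rewrite mulmxBl -mulmxA NM mulmx1 subrK => ? ?.
  exact/ysectionP.
move/ysectionP => -[/= ? ?]; apply/ysectionP.
by split; rewrite /= mulmxBl -mulmxA NM mulmx1 ?subrK.
Qed.

End invariance.

(** * Boxes, and invariance under orthogonal maps *)

Section boxes.
Context {R : realType}.

Lemma open_open_box n (lo hi : 'rV[R]_n) : open (open_box lo hi).
Proof.
have -> : open_box lo hi = \big[setI/setT]_(i < n)
    ((fun y : 'rV[R]_n => y ord0 i) @^-1` `]lo ord0 i, hi ord0 i[%classic).
  rewrite -bigcap_seq; apply/seteqP; split=> y yb i.
    by move=> _; rewrite /= in_itv/=; exact: yb.
  by have := yb i; rewrite /= in_itv/=; apply; rewrite mem_index_enum.
elim/big_ind: _ => [||i _]; [exact: openT|exact: openI|].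
by apply: open_comp; [move=> x _; exact: coord_continuous|exact: interval_open].
Qed.

Lemma measurable_open_box n (lo hi : 'rV[R]_n) : measurable (open_box lo hi).
Proof. by apply: open_measurable_rV; exact: open_open_box. Qed.

Lemma lebesgue_open_box n (lo hi : 'rV[R]_n) :
  (forall i, lo ord0 i < hi ord0 i) ->
  lebesgue_rV n (open_box lo hi) = (\prod_i (hi ord0 i - lo ord0 i))%:E.
Proof.
elim: n lo hi => [|n IH] lo hi lohi.
  rewrite big_ord0 (_ : open_box lo hi = setT); first exact: diracT.
  by apply/seteqP; split => // x _ [].
rewrite lebesgue_rVS.
pose lo' : 'rV[R]_n := \row_i lo ord0 (lift ord0 i).
pose hi' : 'rV[R]_n := \row_i hi ord0 (lift ord0 i).
have -> : @rV_cons R n @^-1` open_box lo hi =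
    (`]lo ord0 ord0, hi ord0 ord0[%classic : set (measurableTypeR R)) `*` open_box lo' hi'.
  apply/seteqP; split=> p /=.
    move=> H; split=> [|i].
      by rewrite in_itv/=; have := H ord0; rewrite -/(rV_coord ord0 (rV_cons p)) rV_cons0.
    by rewrite !mxE; have := H (lift ord0 i); rewrite -/(rV_coord _ (rV_cons p)) rV_consS.
  move=> [p1 p2] i; case: (unliftP ord0 i) => [k|] ->.
    by rewrite -/(rV_coord _ (rV_cons p)) rV_consS; have := p2 k; rewrite !mxE.
  by rewrite -/(rV_coord _ (rV_cons p)) rV_cons0; move: p1; rewrite in_itv.
rewrite product_measure1E//; last exact: measurable_open_box.
rewrite [X in (X * _)%E](_ : _ = (hi ord0 ord0 - lo ord0 ord0)%:E); last first.
  by rewrite /= lebesgue_measure_itv/= lte_fin lohi -EFinB.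
rewrite IH; last by move=> i; rewrite !mxE.
rewrite big_ord_recl EFinM; congr (_ * _)%E; congr EFin.
by apply: eq_bigr => i _; rewrite !mxE.
Qed.

(** A ball [G] centred at the origin satisfies [M^-1 G = G], so [lebesgue_rV_linear]
    applied to [M] and to the identity shows that [M^-1 A] and [A] have the same
    measure as [- A]. *)
Lemma lebesgue_rV_orth n (M : 'M[R]_n) A : M *m M^T = 1%:M -> measurable A ->
  lebesgue_rV n ((fun x => x *m M) @^-1` A) = lebesgue_rV n A.
Proof.
move=> MM mA; set nu := lebesgue_rV n.
pose sq (x : 'rV[R]_n) := \sum_i (x ord0 i) ^+ 2.
have sqE x : sq x = (x *m x^T) ord0 ord0.
  by rewrite mxE; apply: eq_bigr => i _; rewrite mxE expr2.
(* With this radius the ball contains the cube ]-1, 1[^n and is contained in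
   ]-(n+2), n+2[^n, so that its measure is positive and finite. *)
pose G := [set x | sq x <= n.+1%:R].
have mG : measurable G.
  have msq : measurable_fun setT sq.
    apply: measurable_sum => i; apply: measurable_funX.
    exact: (measurable_rV_coord i).
  rewrite (_ : G = sq @^-1` `]-oo, n.+1%:R]%classic).
    exact: (measurable_preimageT msq).
  by apply/seteqP; split => x /=; rewrite in_itv.
have MG : (fun x => x *m M) @^-1` G = G.
  apply/seteqP; split => x /=; rewrite /G/= !sqE trmx_mul mulmxA -(mulmxA x).
    by rewrite MM mulmx1.
  by rewrite MM mulmx1.
have Gfin : (nu G < +oo)%E.
  pose lo : 'rV[R]_n := const_mx (- n.+2%:R).
  pose hi : 'rV[R]_n := const_mx (n.+2%:R).
  apply: (@le_lt_trans _ _ (nu (open_box lo hi))).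
    apply: le_measure; rewrite ?inE//; first exact: measurable_open_box.
    move=> x Gx i; rewrite !mxE -ltr_norml.
    rewrite -(@ltr_pXn2r _ 2)// ?nnegrE// real_normK ?num_real//.
    apply: (@le_lt_trans _ _ (sq x)).
      by rewrite /sq (bigD1 i)//= lerDl sumr_ge0// => k _; exact: sqr_ge0.
    apply: (le_lt_trans Gx); rewrite -natrX ltr_nat.
    by rewrite (@leq_trans n.+2)// expnS leq_pmulr.
  by rewrite lebesgue_open_box ?ltry// => i; rewrite !mxE gtrN// ltr0n.
have Gpos : (0 < nu G)%E.
  pose lo : 'rV[R]_n := const_mx (- 1).
  pose hi : 'rV[R]_n := const_mx 1.
  apply: (@lt_le_trans _ _ (nu (open_box lo hi))).
    rewrite lebesgue_open_box => [|i]; last by rewrite !mxE; lra.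
    by rewrite lte_fin prodr_gt0// => i _; rewrite !mxE; lra.
  apply: le_measure; rewrite ?inE//; first exact: measurable_open_box.
  move=> x bx; rewrite /G/= /sq (@le_trans _ _ (\sum_(i < n) 1))//.
    apply: ler_sum => i _; have := bx i; rewrite !mxE => xi.
    by rewrite -real_normK ?num_real// expr_le1// ltW// ltr_norml.
  by rewrite sumr_const card_ord ler_nat.
have H1 := lebesgue_rV_linear (mulmx1C MM) mA mG.
have H2 := lebesgue_rV_linear (mulmx1 (1%:M : 'M[R]_n)) mA mG.
have i1 B : (fun x : 'rV[R]_n => x *m 1%:M) @^-1` B = B.
  by apply/seteqP; split => x /=; rewrite mulmx1.
rewrite MG in H1; rewrite !i1 -H1 in H2.
have Gf : nu G \is a fin_num by rewrite ge0_fin_numE// ltW.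
by apply: le_anti; apply/andP; split; rewrite -(lee_pmul2r Gf Gpos) H2.
Qed.

Lemma perm_mx_orth n (s : 'S_n) : perm_mx s *m (perm_mx s)^T = 1%:M :> 'M[R]_n.
Proof. by rewrite tr_perm_mx -perm_mxM mulgV perm_mx1. Qed.

(** Singles out the coordinate [j] in Fubini's theorem; with a fixed first
    component it also parametrizes the hyperplanes that contain the faces of a box. *)
Definition rV_insert n (j : 'I_n.+1) (p : measurableTypeR R * 'rV[R]_n) : 'rV[R]_n.+1 :=
  \row_i if unlift j i is Some k then p.2 ord0 k else p.1.

(** Insertion at [j] is insertion at 0 followed by a permutation of the
    coordinates, which is an orthogonal map. *)
Lemma rV_insertE n (j : 'I_n.+1) p : rV_insert j p =
  rV_cons p *m (perm_mx (lift_perm j ord0 1))^T.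
Proof.
rewrite tr_perm_mx -col_permE; apply/rowP => i; rewrite [LHS]mxE [RHS]mxE.
case: unliftP => [k|] ->.
  by rewrite lift_perm_lift perm1 -/(rV_coord _ (rV_cons p)) rV_consS.
by rewrite lift_perm_id -/(rV_coord _ (rV_cons p)) rV_cons0.
Qed.

Lemma measurable_rV_insert n (j : 'I_n.+1) : measurable_fun setT (rV_insert j).
Proof.
have -> : rV_insert j = (fun x => x *m (perm_mx (lift_perm j ord0 1))^T) \o (@rV_cons R n).
  by apply/funext => p; rewrite rV_insertE.
by apply: measurableT_comp; [exact: measurable_mulmx|exact: measurable_rV_cons].
Qed.

Lemma lebesgue_rV_insert n (j : 'I_n.+1) (A : set 'rV[R]_n.+1) : measurable A ->
  lebesgue_rV n.+1 A = (lebesgue_measure \x lebesgue_rV n)%E (rV_insert j @^-1` A).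
Proof.
move=> mA; set P := (perm_mx (lift_perm j ord0 1))^T : 'M[R]_n.+1.
have PP : P *m P^T = 1%:M by rewrite /P trmxK; exact/mulmx1C/perm_mx_orth.
rewrite -(lebesgue_rV_orth PP mA) lebesgue_rVS.
congr ((_ \x _)%E _).
by apply/seteqP; split => p /=; rewrite rV_insertE.
Qed.

End boxes.

(** * Change of variables, Fubini and the divergence theorem on a box *)

Section integration.
Context {R : realType}.

Lemma integral_rV_orth n (M : 'M[R]_n) (D : set 'rV[R]_n) (f : 'rV[R]_n -> \bar R) :
  M *m M^T = 1%:M -> measurable D -> measurable_fun setT f ->
  (lebesgue_rV n).-integrable ((fun x => x *m M) @^-1` D) (fun x => f (x *m M)) ->
  (\int[lebesgue_rV n]_(x in D) f x =
   \int[lebesgue_rV n]_(x in (fun x => x *m M) @^-1` D) f (x *m M))%E.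
Proof.
move=> MM mD mf intf.
rewrite -(integral_pushforward (@measurable_mulmx R n n M) mf intf mD).
apply: eq_measure_integral => [|mM A mA _]; first exact: measurable_mulmx.
by rewrite -[LHS](lebesgue_rV_orth MM mA).
Qed.

Lemma integrable_rV_insert n (j : 'I_n.+1) (f : 'rV[R]_n.+1 -> \bar R) :
  (lebesgue_rV n.+1).-integrable setT f ->
  (lebesgue_measure \x lebesgue_rV n)%E.-integrable setT (f \o @rV_insert R n j).
Proof.
move=> /integrableP[mf fy]; apply/integrableP; split.
  exact: (measurableT_comp mf (measurable_rV_insert j)).
have E : (\int[lebesgue_rV n.+1]_x `|f x| =
    \int[pushforward (lebesgue_measure \x lebesgue_rV n)%E (@rV_insert R n j)]_x `|f x|)%E.
  apply: eq_measure_integral => [|mi A mA _]; first exact: measurable_rV_insert.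
  exact: lebesgue_rV_insert.
move: fy; rewrite E (ge0_integral_pushforward (measurable_rV_insert j) _ measurableT)//.
exact: measurableT_comp.
Qed.

Lemma fubini_rV_insert n (j : 'I_n.+1) (f : 'rV[R]_n.+1 -> \bar R) :
  (lebesgue_rV n.+1).-integrable setT f ->
  (\int[lebesgue_rV n.+1]_x f x =
   \int[lebesgue_rV n]_z \int[lebesgue_measure]_s f (rV_insert j (s, z)))%E.
Proof.
move=> intf; have intf' := integrable_rV_insert j intf.
have /integrableP[mf _] := intf.
rewrite (integral21_prod_meas1 intf').
have := integral_pushforward (measurable_rV_insert j) mf intf' measurableT.
rewrite preimage_setT => <-.
apply: eq_measure_integral => [|mi A mA _]; first exact: measurable_rV_insert.
exact: lebesgue_rV_insert.
Qed.

Lemma open_box_insert n (j : 'I_n.+1) (lo hi : 'rV[R]_n.+1) s z :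
  open_box lo hi (rV_insert j (s, z)) <->
  lo ord0 j < s < hi ord0 j /\ open_box (col' j lo) (col' j hi) z.
Proof.
split=> [H|[Hs Hz] i].
  split=> [|i]; first by have := H j; rewrite mxE unlift_none.
  by rewrite !mxE; have := H (lift j i); rewrite mxE liftK.
rewrite mxE; case: unliftP => [k|] -> //.
by have := Hz k; rewrite !mxE.
Qed.

Lemma fubini_box n (j : 'I_n.+1) (lo hi : 'rV[R]_n.+1) (f : 'rV[R]_n.+1 -> \bar R) :
  (lebesgue_rV n.+1).-integrable (open_box lo hi) f ->
  (\int[lebesgue_rV n.+1]_(x in open_box lo hi) f x =
   \int[lebesgue_rV n]_(z in open_box (col' j lo) (col' j hi))
     \int[lebesgue_measure]_(s in `]lo ord0 j, hi ord0 j[) f (rV_insert j (s, z)))%E.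
Proof.
move=> intf; rewrite integral_mkcond (fubini_rV_insert j); last first.
  exact: (integrable_mkcond f (measurable_open_box lo hi)).1.
rewrite [RHS]integral_mkcond; apply: eq_integral => z _.
rewrite [RHS]patchE; case: ifPn => [/set_mem zb|/negP zb].
  rewrite [RHS]integral_mkcond; apply: eq_integral => s _.
  rewrite !patchE.
  have [sb|sb] := pselect (lo ord0 j < s < hi ord0 j).
    have yb : open_box lo hi (rV_insert j (s, z)) by exact/open_box_insert.
    by rewrite (mem_set yb) mem_set//= in_itv.
  have yb : ~ open_box lo hi (rV_insert j (s, z)) by move=> /open_box_insert[].
  by rewrite (memNset yb) memNset//= in_itv.
rewrite integral0_eq// => s _; rewrite patchE memNset//.
by move/open_box_insert => [_ /mem_set].
Qed.

Definition closed_box n (lo hi : 'rV[R]_n) : set 'rV[R]_n :=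
  [set y | forall i, lo ord0 i <= y ord0 i <= hi ord0 i].

Lemma open_closed_box n (lo hi : 'rV[R]_n) : open_box lo hi `<=` closed_box lo hi.
Proof. by move=> y yb i; have /andP[/ltW -> /ltW ->] := yb i. Qed.

Lemma closed_box_insert n (j : 'I_n.+1) (lo hi : 'rV[R]_n.+1) s z :
  lo ord0 j <= s <= hi ord0 j -> open_box (col' j lo) (col' j hi) z ->
  closed_box lo hi (rV_insert j (s, z)).
Proof.
move=> Hs Hz i; rewrite mxE; case: unliftP => [k|] -> //.
by have := Hz k; rewrite !mxE => /andP[/ltW -> /ltW ->].
Qed.

Lemma compact_closed_box n (lo hi : 'rV[R]_n) : compact (closed_box lo hi).
Proof.
have -> : closed_box lo hi = [set v : 'rV[R]_n | forall i, `[lo ord0 i, hi ord0 i]%classic (v ord0 i)].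
  by apply/seteqP; split => y H i; have := H i; rewrite /= in_itv.
by apply: (@rV_compact R n (fun i => `[lo ord0 i, hi ord0 i]%classic)) => i; exact: segment_compact.
Qed.

Lemma bounded_closed_box n (lo hi : 'rV[R]_n) (f : 'rV[R]_n -> R) :
  (forall i, lo ord0 i < hi ord0 i) ->
  (forall y, closed_box lo hi y -> {for y, continuous f}) ->
  exists C, forall y, closed_box lo hi y -> `|f y| <= C.
Proof.
move=> lohi cf.
have [||c _ cmax] := @EVT_max_rV R n (fun y => `|f y|) _ _ (@compact_closed_box n lo hi).
- by exists lo => i; rewrite lexx ltW.
- apply: continuous_in_subspaceT => y /set_mem yb.
  by apply: (@continuous_comp _ _ _ f (fun x => `|x|)); [exact: cf|exact: norm_continuous].
by exists `|f c| => y yb; apply: cmax; exact: mem_set.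
Qed.

Lemma integrable_open_box n (lo hi : 'rV[R]_n) (f : 'rV[R]_n -> R) :
  (forall i, lo ord0 i < hi ord0 i) ->
  (forall y, closed_box lo hi y -> {for y, continuous f}) ->
  (lebesgue_rV n).-integrable (open_box lo hi) (EFin \o f).
Proof.
move=> lohi cf; have [C HC] := bounded_closed_box lohi cf.
apply: measurable_bounded_integrable => //.
- exact: measurable_open_box.
- by rewrite [X in (X < _)%E](lebesgue_open_box lohi) ltry.
- apply: continuous_measurable_rV; first exact: open_open_box.
  by move=> y /set_mem yb; apply: cf; exact: open_closed_box.
- exists C; split; first exact: num_real.
  by move=> r Cr y yb; apply: le_trans (ltW Cr); apply: HC; exact: open_closed_box.
Qed.

(** The two difference quotients are the same function. This transports
    directional derivatives along affine maps. *)
Lemma is_derive_line (V W : normedModType R) (F : V -> R) (q : W -> V) y u v l :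
  (forall h : R, q (h *: u + y) = h *: v + q y) ->
  is_derive (q y) v F l <-> is_derive y u (F \o q) l.
Proof.
move=> Hq.
have E : (fun h : R => h^-1 *: ((F \o shift (q y)) (h *: v) - F (q y))) =
         (fun h : R => h^-1 *: (((F \o q) \o shift y) (h *: u) - (F \o q) y)).
  by apply/funext => h /=; rewrite -Hq.
by split=> -[]; rewrite /derivable /derive ?E -?E => d1 d2; split;
  rewrite /derivable /derive ?E -?E.
Qed.

Lemma rV_insert_line n (j : 'I_n.+1) z (s h : R) :
  rV_insert j (h + s : measurableTypeR R, z) = h *: delta_mx ord0 j + rV_insert j (s : measurableTypeR R, z).
Proof.
apply/rowP => i; rewrite !mxE eqxx /=; case: unliftP => [k|] ->.
  by rewrite eq_sym (negbTE (neq_lift _ _)) mulr0 add0r.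
by rewrite eqxx mulr1.
Qed.

Lemma rV_insert_continuous n (j : 'I_n.+1) z :
  continuous (fun s : R => rV_insert j (s : measurableTypeR R, z)).
Proof.
have -> : (fun s : R => rV_insert j (s : measurableTypeR R, z)) =
    (fun s : R => s *: delta_mx ord0 j + rV_insert j (0 : measurableTypeR R, z)).
  by apply/funext => s; rewrite -{1}(addr0 s) rV_insert_line.
move=> s; apply: cvgD; last exact: cvg_cst.
by apply: cvgZr_tmp; exact: cvg_id.
Qed.

(** Fubini's theorem in the coordinate [j] and the fundamental theorem of calculus
    on each segment. The hypotheses are made on the closed box only, because the
    logarithmic derivative of a mode may be singular just outside of it. *)
Lemma divergence_box n (lo hi : 'rV[R]_n.+1) (j : 'I_n.+1) (F dF : 'rV[R]_n.+1 -> R) :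
  (forall i, lo ord0 i < hi ord0 i) ->
  (forall y, closed_box lo hi y -> is_derive y (delta_mx ord0 j) F (dF y)) ->
  (forall y, closed_box lo hi y -> {for y, continuous dF}) ->
  \int[lebesgue_rV n.+1]_(y in open_box lo hi) dF y =
  \int[lebesgue_rV n]_(z in open_box (col' j lo) (col' j hi))
    (F (rV_insert j (hi ord0 j, z)) - F (rV_insert j (lo ord0 j, z))).
Proof.
move=> lohi FdF cdF; rewrite /Rintegral; congr fine.
rewrite (fubini_box j (integrable_open_box lohi cdF)).
apply: eq_integral => z /set_mem zb.
pose q (s : R) := rV_insert j (s : measurableTypeR R, z).
have qb s : s \in `[lo ord0 j, hi ord0 j] -> closed_box lo hi (q s).
  by rewrite in_itv => sb; exact: closed_box_insert.
have dp s : s \in `[lo ord0 j, hi ord0 j] -> is_derive s 1 (F \o q) (dF (q s)).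
  move=> sb; have Hq (h : R) : q (h *: 1 + s) = h *: delta_mx ord0 j + q s.
    by rewrite /q [h *: _]mulr1; exact: rV_insert_line.
  by apply/(is_derive_line F (dF (q s)) Hq); exact/FdF/qb.
have cp s : s \in `[lo ord0 j, hi ord0 j] -> {for s, continuous (F \o q)}.
  move=> /dp[ds _]; apply: differentiable_continuous; exact/derivable1_diffP.
have cdq s : s \in `[lo ord0 j, hi ord0 j] -> {for s, continuous (dF \o q)}.
  move=> sb; apply: continuous_comp; first exact: rV_insert_continuous.
  exact/cdF/qb.
have oc s : s \in `]lo ord0 j, hi ord0 j[ -> s \in `[lo ord0 j, hi ord0 j].
  by rewrite !in_itv/= => /andP[/ltW -> /ltW ->].
have := @continuous_FTC2 R (dF \o q) (F \o q) _ _ (lohi j).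
rewrite integral_itv_bndoo; last first.
  apply/measurable_EFinP; apply: open_continuous_measurable_fun; first exact: interval_open.
  by move=> s /set_mem /= /oc; exact: cdq.
move=> ->//.
- by apply: continuous_in_subspaceT => s /set_mem; exact: cdq.
- split.
  + by move=> s /oc /dp[].
  + by apply: cvg_at_right_filter; apply: cp; rewrite in_itv/= lexx ltW ?lohi.
  + by apply: cvg_at_left_filter; apply: cp; rewrite in_itv/= lexx andbT ltW.
- by move=> s /oc /dp ds; rewrite derive1E derive_val.
Qed.

End integration.

(** * Functions of class C1 *)

Section continuously_differentiable.
Context {R : realType}.

Lemma mulmx_row_sum m n (M : 'M[R]_(m, n)) (x : 'rV[R]_m) :
  x *m M = \sum_k x ord0 k *: row k M.
Proof.
by apply/rowP => i; rewrite mxE summxE; apply: eq_bigr => k _; rewrite !mxE.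
Qed.

Lemma differentiable_mulmx m n (M : 'M[R]_(m, n)) (x : 'rV[R]_m) :
  differentiable (fun x : 'rV[R]_m => x *m M) x.
Proof.
have -> : (fun x : 'rV[R]_m => x *m M) =
    \sum_(k < m) (fun x : 'rV[R]_m => x ord0 k *: row k M).
  by apply/funext => y; rewrite mulmx_row_sum fct_sumE.
apply: differentiable_sum => k; apply: differentiableZl.
exact: differentiable_coord.
Qed.

Lemma continuous_mulmx m n (M : 'M[R]_(m, n)) :
  continuous (fun x : 'rV[R]_m => x *m M).
Proof. by move=> x; apply: differentiable_continuous; exact: differentiable_mulmx. Qed.

Lemma derive_rV n (f : 'rV[R]_n -> R) x v : differentiable f x ->
  'D_v f x = \sum_i v ord0 i * partial i f x.
Proof.
move=> df; rewrite deriveE// [in LHS](row_sum_delta v) linear_sum.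
by apply: eq_bigr => i _; rewrite linearZ /partial deriveE.
Qed.

Lemma C1_continuous n (f : 'rV[R]_n -> R) : C1 f -> continuous f.
Proof. by move=> [df _] x; exact: differentiable_continuous. Qed.

Lemma C1_is_derive n (f : 'rV[R]_n -> R) i x : C1 f ->
  is_derive x (delta_mx ord0 i) f (partial i f x).
Proof. by move=> [df _]; split=> //; exact: diff_derivable. Qed.

Lemma partial_mulmx n (f : 'rV[R]_n -> R) (M : 'M[R]_n) j y :
  differentiable f (y *m M) ->
  partial j (fun y => f (y *m M)) y = \sum_i M j i * partial i f (y *m M).
Proof.
move=> df; have Hq (h : R) : (h *: delta_mx ord0 j + y) *m M = h *: row j M + y *m M.
  by rewrite mulmxDl -scalemxAl -rowE.
have : is_derive (y *m M) (row j M) f ('D_(row j M) f (y *m M)).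
  by split=> //; exact: diff_derivable.
move=> /(is_derive_line f (q := fun y => y *m M) _ Hq)[_ Hd].
rewrite /partial [LHS]Hd derive_rV//.
by apply: eq_bigr => i _; rewrite mxE.
Qed.

Lemma cvg_big_sum (T : Type) (F : set_system T) {FF : Filter F} (I : Type)
    (r : seq I) (f : I -> T -> R) (l : I -> R) :
  (forall i, f i x @[x --> F] --> l i) ->
  \sum_(i <- r) f i x @[x --> F] --> \sum_(i <- r) l i.
Proof.
move=> fl; elim: r => [|i r IH].
  by rewrite big_nil; under eq_fun do rewrite big_nil; exact: cvg_cst.
by rewrite big_cons; under eq_fun do rewrite big_cons; exact: cvgD.
Qed.

Lemma C1_mulmx n (f : 'rV[R]_n -> R) (M : 'M[R]_n) : C1 f ->
  C1 (fun y => f (y *m M)).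
Proof.
move=> C1f; have [df pf] := C1f; split.
  by move=> y; apply: differentiable_comp => //; exact: differentiable_mulmx.
move=> j; have -> : partial j (fun y => f (y *m M)) =
   fun y => \sum_i M j i * partial i f (y *m M).
  by apply/funext => y; rewrite partial_mulmx.
move=> y; apply: (@cvg_big_sum _ _ (nbhs_filter y)) => i.
apply: cvgM; first exact: cvg_cst.
apply: (@continuous_comp _ _ _ (fun y : 'rV[R]_n => y *m M) (partial i f) y); first exact: continuous_mulmx.
exact: pf.
Qed.

Lemma C1_cst n (c : R) : C1 (fun _ : 'rV[R]_n => c).
Proof.
split=> [x|i]; first exact: differentiable_cst.
have -> : partial i (fun _ : 'rV[R]_n => c) = fun _ => 0.
  by apply/funext => x; exact: derive_cst.
exact: cst_continuous.
Qed.

Lemma partialM n (f g : 'rV[R]_n -> R) i x : C1 f -> C1 g ->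
  partial i (fun x => f x * g x) x = f x * partial i g x + g x * partial i f x.
Proof.
by move=> [df _] [dg _]; rewrite /partial [LHS]deriveM//; exact: diff_derivable.
Qed.

Lemma C1M n (f g : 'rV[R]_n -> R) : C1 f -> C1 g -> C1 (fun x => f x * g x).
Proof.
move=> C1f C1g; have [df pf] := C1f; have [dg pg] := C1g.
split=> [x|i]; first exact: differentiableM.
have -> : partial i (fun x => f x * g x) =
    fun x => f x * partial i g x + g x * partial i f x.
  by apply/funext => x; exact: partialM.
move=> x.
apply: (@continuousD _ _ _ (f \* partial i g) (g \* partial i f)).
  by apply: continuousM; [exact: C1_continuous|exact: pg].
by apply: continuousM; [exact: C1_continuous|exact: pf].
Qed.

Lemma C1_prod n (I : Type) (r : seq I) (f : I -> 'rV[R]_n -> R) :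
  (forall i, C1 (f i)) -> C1 (fun x => \prod_(i <- r) f i x).
Proof.
move=> C1f; elim: r => [|i r IH].
  under eq_fun do rewrite big_nil; exact: C1_cst.
by under eq_fun do rewrite big_cons; exact: C1M.
Qed.

Lemma is_derive_coord n (p : R -> R) (i : 'I_n) (y : 'rV[R]_n) (a l : R) :
  is_derive (y ord0 i - a) 1 p l ->
  is_derive y (delta_mx ord0 i) (fun y => p (y ord0 i - a)) l.
Proof.
apply: (is_derive_line p (q := fun y : 'rV[R]_n => y ord0 i - a) _ _).1 => h.
by rewrite !mxE !eqxx/= [h *: (1 : R)]mulr1 mulr1 addrA.
Qed.

(** The function is constant along the directions [j != i]. *)
Lemma partial_coord n (p dp : R -> R) (i j : 'I_n) (a : R) (y : 'rV[R]_n) :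
  (forall s : R, is_derive s 1 p (dp s)) ->
  partial j (fun y => p (y ord0 i - a)) y = if j == i then dp (y ord0 i - a) else 0.
Proof.
move=> dpE; case: eqP => [->|/eqP ji].
  by rewrite /partial; have [_ ->] := is_derive_coord (dpE (y ord0 i - a)).
have Hq (h : R) : (h *: delta_mx ord0 j + y) ord0 i - a = h *: (0 : R) + (y ord0 i - a).
  by rewrite !mxE eqxx eq_sym (negbTE ji) mulr0 scaler0 !add0r.
rewrite /partial.
by have [_ ->] := (is_derive_line p (q := fun y : 'rV[R]_n => y ord0 i - a) 0 Hq).1
  (is_derive0 p (y ord0 i - a)).
Qed.

Lemma C1_coord n (p dp : R -> R) (i : 'I_n) (a : R) :
  (forall s : R, is_derive s 1 p (dp s)) -> continuous dp ->
  C1 (fun y : 'rV[R]_n => p (y ord0 i - a)).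
Proof.
move=> dpE cdp.
have cc (y : 'rV[R]_n) : differentiable (fun y : 'rV[R]_n => y ord0 i - a) y.
  apply: differentiableB; first exact: differentiable_coord.
  exact: differentiable_cst.
split=> [y|j].
  apply: (@differentiable_comp _ _ _ _ (fun y : 'rV[R]_n => y ord0 i - a) p) => //.
  by apply/derivable1_diffP; have [] := dpE (y ord0 i - a).
have -> : partial j (fun y : 'rV[R]_n => p (y ord0 i - a)) =
    fun y => if j == i then dp (y ord0 i - a) else 0.
  by apply/funext => y; exact: partial_coord.
case: eqP => _ y; last exact: cst_continuous.
apply: (@continuous_comp _ _ _ (fun y : 'rV[R]_n => y ord0 i - a) dp); last exact: cdp.
exact: differentiable_continuous.
Qed.

End continuously_differentiable.

(** * Modes of an interval and the energy identity in one direction *)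

Section continuity_at_a_point.
Context {R : realType} {T : topologicalType}.
Implicit Types (f g : T -> R) (x : T).

Lemma cont_ptD f g x : {for x, continuous f} -> {for x, continuous g} ->
  {for x, continuous (fun y => f y + g y)}.
Proof. exact: continuousD. Qed.

Lemma cont_ptB f g x : {for x, continuous f} -> {for x, continuous g} ->
  {for x, continuous (fun y => f y - g y)}.
Proof. exact: continuousB. Qed.

Lemma cont_ptM f g x : {for x, continuous f} -> {for x, continuous g} ->
  {for x, continuous (fun y => f y * g y)}.
Proof. exact: continuousM. Qed.

Lemma cont_ptX2 f x : {for x, continuous f} -> {for x, continuous (fun y => f y ^+ 2)}.
Proof. by move=> cf; exact: (cont_ptM cf cf). Qed.

Lemma cont_pt_cst (c : R) x : {for x, continuous (fun _ : T => c)}.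
Proof. exact: cst_continuous. Qed.

End continuity_at_a_point.

Section robin_mode.
Context {R : realType}.

Definition robin_mode (alpha l lam : R) (phi dphi : R -> R) : Prop :=
  [/\ forall s : R, is_derive s 1 phi (dphi s),
      forall s : R, is_derive s 1 dphi (- lam * phi s),
      forall s, 0 <= s <= l -> 0 < phi s,
      dphi 0 = alpha * phi 0 & dphi l = - alpha * phi l].

(** The Riccati equation. *)
Lemma mode_log_derivative alpha l lam phi dphi s :
  robin_mode alpha l lam phi dphi -> 0 <= s <= l ->
  is_derive (s : R) 1 (fun t => dphi t / phi t) (- lam - (dphi s / phi s) ^+ 2).
Proof.
move=> [dphiE ddphiE phi0 _ _] /phi0 phis.
have phis0 : phi s != 0 by rewrite gt_eqF.
have dV := @is_deriveV _ phi s _ 1 phis0 (dphiE s).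
have := is_deriveM (ddphiE s) dV.
move=> H; apply: is_derive_eq H _.
by rewrite /GRing.scale/=; field.
Qed.

Lemma derive_continuous (f : R -> R) (s l : R) : is_derive s 1 f l -> {for s, continuous f}.
Proof. by move=> [d _]; apply: differentiable_continuous; exact/derivable1_diffP. Qed.

Lemma coord_continuous_sub n (i : 'I_n) (a : R) (y : 'rV[R]_n) :
  {for y, continuous (fun y : 'rV[R]_n => y ord0 i - a)}.
Proof. by apply: cont_ptB; [exact: coord_continuous|exact: cont_pt_cst]. Qed.

Lemma rV_insert_continuous_face m (j : 'I_m.+1) (c : measurableTypeR R) :
  continuous (fun z : 'rV[R]_m => rV_insert j (c, z)).
Proof.
have -> : (fun z : 'rV[R]_m => rV_insert j (c, z)) =
    (fun z => z *m (\matrix_(k < m) delta_mx ord0 (lift j k)) + rV_insert j (c, 0)).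
  apply/funext => z; rewrite mulmx_row_sum; apply/rowP => i.
  rewrite !mxE summxE; case: unliftP => [k|] ->.
    rewrite (bigD1 k)//= !mxE !eqxx mulr1 big1 ?addr0 ?mxE// => l lk.
    by rewrite !mxE eqxx (inj_eq lift_inj) eq_sym (negbTE lk) mulr0.
  rewrite big1 ?add0r// => l _.
  by rewrite !mxE eqxx (negbTE (neq_lift _ _)) mulr0.
set N := \matrix_k _; set b := rV_insert _ _ => z.
apply: (@continuousD _ _ _ (fun z : 'rV[R]_m => z *m N) (fun=> b)).
  exact: continuous_mulmx.
exact: cst_continuous.
Qed.

(** The divergence theorem applied to [F = w G ^ 2] in the direction [j], where
    [w = dphi / phi]: the Riccati equation makes [dG ^ 2 - lam G ^ 2 - dF] the square
    of [dG - w G], and the boundary conditions give [w = alpha] and [w = - alpha] on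
    the two faces. *)
Lemma coordinate_energy_identity m (lo hi : 'rV[R]_m.+1) j (G dG : 'rV[R]_m.+1 -> R)
    alpha lam phi dphi :
  (forall i, lo ord0 i < hi ord0 i) ->
  robin_mode alpha (hi ord0 j - lo ord0 j) lam phi dphi ->
  (forall y, is_derive y (delta_mx ord0 j) G (dG y)) ->
  continuous G -> continuous dG ->
  \int[lebesgue_rV m.+1]_(y in open_box lo hi) (dG y ^+ 2) +
  alpha * (\int[lebesgue_rV m]_(z in open_box (col' j lo) (col' j hi))
             (G (rV_insert j (hi ord0 j, z)) ^+ 2) +
           \int[lebesgue_rV m]_(z in open_box (col' j lo) (col' j hi))
             (G (rV_insert j (lo ord0 j, z)) ^+ 2)) -
  lam * \int[lebesgue_rV m.+1]_(y in open_box lo hi) (G y ^+ 2) =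
  \int[lebesgue_rV m.+1]_(y in open_box lo hi)
    ((dG y - dphi (y ord0 j - lo ord0 j) / phi (y ord0 j - lo ord0 j) * G y) ^+ 2).
Proof.
move=> lohi mode GdG cG cdG.
have [dphiE ddphiE phi0 mode0 model] := mode.
pose w t := dphi t / phi t.
pose r (y : 'rV[R]_m.+1) := y ord0 j - lo ord0 j.
have rb y : closed_box lo hi y -> 0 <= r y <= hi ord0 j - lo ord0 j.
  by move=> /(_ j); rewrite /r subr_ge0 lerD2r.
pose F y := w (r y) * G y ^+ 2.
pose dF y := w (r y) * (2 * G y * dG y) + G y ^+ 2 * (- lam - w (r y) ^+ 2).
have cw y : closed_box lo hi y -> {for y, continuous (fun y => w (r y))}.
  move=> /rb yb; apply: (@continuous_comp _ _ _ r w); first exact: coord_continuous_sub.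
  exact: derive_continuous (mode_log_derivative mode yb).
have cdF y : closed_box lo hi y -> {for y, continuous dF}.
  move=> yb; apply: cont_ptD.
    apply: cont_ptM; first exact: cw.
    apply: cont_ptM; last exact: cdG.
    by apply: cont_ptM; [exact: cont_pt_cst|exact: cG].
  apply: cont_ptM; first by apply: cont_ptX2; exact: cG.
  by apply: cont_ptB; [exact: cont_pt_cst|apply: cont_ptX2; exact: cw].
have FdF y : closed_box lo hi y -> is_derive y (delta_mx ord0 j) F (dF y).
  move=> yb; have := is_deriveM (is_derive_coord (mode_log_derivative mode (rb _ yb))) (is_deriveX 2 (GdG y)).
  move=> H; apply: is_derive_eq H _.
  by rewrite /GRing.scale/= /dF /w /r /= expr1.
have iG2 : (lebesgue_rV m.+1).-integrable (open_box lo hi) (EFin \o (fun y => G y ^+ 2)).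
  by apply: integrable_open_box => // y _; apply: cont_ptX2; exact: cG.
have idG2 : (lebesgue_rV m.+1).-integrable (open_box lo hi) (EFin \o (fun y => dG y ^+ 2)).
  by apply: integrable_open_box => // y _; apply: cont_ptX2; exact: cdG.
have idF := integrable_open_box lohi cdF.
have mB := @measurable_open_box R _ lo hi.
have -> : \int[lebesgue_rV m.+1]_(y in open_box lo hi) ((dG y - w (r y) * G y) ^+ 2) =
    \int[lebesgue_rV m.+1]_(y in open_box lo hi) ((dG y ^+ 2 - lam * G y ^+ 2) - dF y).
  by apply: eq_Rintegral => y _; rewrite /dF; ring.
have ilG2 : (lebesgue_rV m.+1).-integrable (open_box lo hi) (EFin \o (fun y => lam * G y ^+ 2)).
  apply: integrable_open_box => // y _; apply: cont_ptM; first exact: cont_pt_cst.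
  by apply: cont_ptX2; exact: cG.
have idl : (lebesgue_rV m.+1).-integrable (open_box lo hi) (EFin \o (fun y => dG y ^+ 2 - lam * G y ^+ 2)).
  apply: integrable_open_box => // y _; apply: cont_ptB; first by apply: cont_ptX2; exact: cdG.
  apply: cont_ptM; first exact: cont_pt_cst.
  by apply: cont_ptX2; exact: cG.
rewrite (RintegralB mB idl idF) (RintegralB mB idG2 ilG2) (RintegralZl _ mB iG2).
rewrite (divergence_box lohi FdF cdF).
have lohi' i : (col' j lo) ord0 i < (col' j hi) ord0 i by rewrite !mxE.
have iface (c : R) : (lebesgue_rV m).-integrable (open_box (col' j lo) (col' j hi))
    (EFin \o (fun z => G (rV_insert j (c : measurableTypeR R, z)) ^+ 2)).
  apply: integrable_open_box => // z _; apply: cont_ptX2.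
  apply: (@continuous_comp _ _ _ (fun z : 'rV[R]_m => rV_insert j (c : measurableTypeR R, z)) G).
    exact: rV_insert_continuous_face.
  exact: cG.
have mF := @measurable_open_box R _ (col' j lo) (col' j hi).
have -> : \int[lebesgue_rV m]_(z in open_box (col' j lo) (col' j hi))
      (F (rV_insert j (hi ord0 j, z)) - F (rV_insert j (lo ord0 j, z))) =
    \int[lebesgue_rV m]_(z in open_box (col' j lo) (col' j hi))
      (- alpha * (G (rV_insert j (hi ord0 j, z)) ^+ 2 + G (rV_insert j (lo ord0 j, z)) ^+ 2)).
  apply: eq_Rintegral => z _; rewrite /F /r !mxE unlift_none /= subrr /w mode0 model.
  have l0 : 0 < hi ord0 j - lo ord0 j by rewrite subr_gt0.
  rewrite !mulfK ?gt_eqF ?phi0 ?lexx ?ltW//; ring.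
have iface2 : (lebesgue_rV m).-integrable (open_box (col' j lo) (col' j hi))
    (EFin \o (fun z => G (rV_insert j (hi ord0 j : measurableTypeR R, z)) ^+ 2 +
      G (rV_insert j (lo ord0 j : measurableTypeR R, z)) ^+ 2)).
  exact: (integrableD mF (iface (hi ord0 j)) (iface (lo ord0 j))).
rewrite (RintegralZl _ mF iface2) (RintegralD mF (iface _) (iface _)).
ring.
Qed.
End robin_mode.

(** * Limits and finite sums of integrals *)

Section L2_limits.
Context {R : realType} d (T : measurableType d) (mu : {measure set T -> \bar R}).

Lemma integrable_sq (D : set T) (f : T -> R) : measurable D -> measurable_fun D f ->
  (\int[mu]_(x in D) ((f x) ^+ 2)%:E < +oo)%E ->
  mu.-integrable D (EFin \o (fun x => f x ^+ 2)).
Proof.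
move=> mD mf fy; apply/integrableP; split.
  by apply/measurable_EFinP; exact: measurable_funX.
by under eq_integral do rewrite /= ger0_norm ?sqr_ge0//.
Qed.

(** For every [dl > 0], the inequality
    [|p ^ 2 - q ^ 2| <= dl p ^ 2 + (1 + 1 / dl) (q - p) ^ 2] bounds the difference of
    the squared norms by [dl] times a constant plus a sequence that tends to 0. *)
Lemma L2_norm_cvg (D : set T) (f : T -> R) (v : nat -> T -> R) : measurable D ->
  measurable_fun D f -> (forall k, measurable_fun D (v k)) ->
  (\int[mu]_(x in D) ((f x) ^+ 2)%:E < +oo)%E ->
  (forall k, (\int[mu]_(x in D) ((v k x) ^+ 2)%:E < +oo)%E) ->
  (\int[mu]_(x in D) ((v k x - f x) ^+ 2)%:E)%E @[k --> \oo] --> 0%E ->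
  \int[mu]_(x in D) (v k x ^+ 2) @[k --> \oo] --> \int[mu]_(x in D) (f x ^+ 2).
Proof.
move=> mD mf mv fy vy vf.
have if2 := integrable_sq mD mf fy.
have iv2 k := integrable_sq mD (mv k) (vy k).
have mvf k : measurable_fun D (fun x => v k x - f x) by exact: measurable_funB.
have ie2 k : mu.-integrable D (EFin \o (fun x => (v k x - f x) ^+ 2)).
  apply: (@le_integrable _ _ _ _ _ mD _ (EFin \o (fun x => 2 * (v k x ^+ 2 + f x ^+ 2)))).
  - by apply/measurable_EFinP; exact: measurable_funX.
  - move=> x _; rewrite /= lee_fin ger0_norm ?sqr_ge0// ger0_norm; last first.
      by rewrite mulr_ge0// addr_ge0// sqr_ge0.
    by have := sqr_ge0 (v k x + f x); lra.
  - exact: (integrableZl mD 2 (integrableD mD (iv2 k) if2)).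
set b := \int[mu]_(x in D) (f x ^+ 2).
pose e k := \int[mu]_(x in D) ((v k x - f x) ^+ 2).
have e0 : e k @[k --> \oo] --> 0 by exact: fine_cvg vf.
have b0 : 0 <= b by apply: Rintegral_ge0 => x _; exact: sqr_ge0.
have bound (dl : R) k : 0 < dl ->
    `|b - \int[mu]_(x in D) (v k x ^+ 2)| <= dl * b + (1 + dl^-1) * e k.
  move=> dl0.
  have key (p q : R) : `|p ^+ 2 - q ^+ 2| <= dl * p ^+ 2 + (1 + dl^-1) * (q - p) ^+ 2.
    have H1 : 0 <= dl^-1 * (dl * p - (q - p)) ^+ 2 by rewrite mulr_ge0 ?sqr_ge0// invr_ge0 ltW.
    have H2 : 0 <= dl^-1 * (dl * p + (q - p)) ^+ 2 by rewrite mulr_ge0 ?sqr_ge0// invr_ge0 ltW.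
    have E1 : dl^-1 * (dl * p - (q - p)) ^+ 2 = dl * p ^+ 2 - 2 * p * (q - p) + dl^-1 * (q - p) ^+ 2.
      by field; rewrite gt_eqF.
    have E2 : dl^-1 * (dl * p + (q - p)) ^+ 2 = dl * p ^+ 2 + 2 * p * (q - p) + dl^-1 * (q - p) ^+ 2.
      by field; rewrite gt_eqF.
    rewrite E1 in H1; rewrite E2 in H2.
    have H3 := sqr_ge0 (q - p).
    rewrite ler_norml mulrDl mul1r; move: H1 H2; set z := dl^-1 * _ => H1 H2.
    by apply/andP; split; nra.
  rewrite -(RintegralB mD if2 (iv2 k)).
  have ia : mu.-integrable D (EFin \o (fun x => dl * f x ^+ 2)) by exact: (integrableZl mD dl if2).
  have ib : mu.-integrable D (EFin \o (fun x => (1 + dl^-1) * (v k x - f x) ^+ 2)).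
    exact: (integrableZl mD (1 + dl^-1) (ie2 k)).
  have iab : mu.-integrable D (EFin \o (fun x => dl * f x ^+ 2 + (1 + dl^-1) * (v k x - f x) ^+ 2)).
    exact: (integrableD mD ia ib).
  have isub : mu.-integrable D (EFin \o (fun x => f x ^+ 2 - v k x ^+ 2)).
    exact: (integrableB mD if2 (iv2 k)).
  apply: (le_trans (le_normr_Rintegral mD isub)).
  rewrite /e -(RintegralZl _ mD if2) -(RintegralZl _ mD (ie2 k)) -(RintegralD mD ia ib).
  apply: le_Rintegral => //.
  exact: (integrable_norm isub).
apply/cvgrPdist_lt => eps eps0.
(* Chosen so that dl b < eps / 2, also when b = 0. *)
pose dl := eps / (2 * (b + 1)).
have b1 : 0 < 2 * (b + 1) by rewrite mulr_gt0// ltr_wpDl.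
have dl0 : 0 < dl by rewrite divr_gt0.
have C0 : 0 < 1 + dl^-1 by rewrite addr_gt0// invr_gt0.
have ec0 : 0 < eps / (2 * (1 + dl^-1)) by rewrite divr_gt0// mulr_gt0.
have /cvgrPdist_lt /(_ _ ec0) := e0.
apply: filterS => k; rewrite sub0r normrN => ek.
apply: le_lt_trans (bound dl k dl0) _.
have h1 : dl * b < eps / 2.
  have -> : eps / 2 = dl * (b + 1) by rewrite /dl; field; rewrite gt_eqF// ltr_wpDl.
  by rewrite ltr_pM2l// ltrDl.
have h2 : (1 + dl^-1) * e k < eps / 2.
  have -> : eps / 2 = (1 + dl^-1) * (eps / (2 * (1 + dl^-1))).
    by move: C0; set C := 1 + _ => C0; field; rewrite gt_eqF.
  by rewrite ltr_pM2l//; exact: le_lt_trans (ler_norm _) ek.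
by rewrite (splitr eps) ltrD.
Qed.

Lemma Rintegral_sum (D : set T) (I : Type) (r : seq I) (f : I -> T -> R) :
  measurable D -> (forall i, mu.-integrable D (EFin \o f i)) ->
  \int[mu]_(x in D) (\sum_(i <- r) f i x) = \sum_(i <- r) \int[mu]_(x in D) f i x.
Proof.
move=> mD fi.
have isum s : mu.-integrable D (EFin \o (fun x => \sum_(i <- s) f i x)).
  elim: s => [|i s IH].
    by under eq_fun do rewrite big_nil; exact: integrable0.
  by under eq_fun do rewrite big_cons; exact: (integrableD mD (fi i) IH).
elim: r => [|i r IH].
  rewrite big_nil; under eq_Rintegral do rewrite big_nil.
  by rewrite /Rintegral integral0.
rewrite big_cons -IH; under eq_Rintegral do rewrite big_cons.
exact: RintegralD.
Qed.

End L2_limits.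

(** * The energy identity on a rotated box *)

Section box_geometry.
Context {R : realType} (n : nat) (B : box R n).
Local Notation M := (box_frame B).
Local Notation lo := (box_lo B).
Local Notation hi := (box_hi B).

Lemma frame_tr_orth : M^T *m M = 1%:M.
Proof. exact/mulmx1C/box_frame_orth. Qed.

Lemma box_setE : box_set B = (fun x => x *m M^T) @^-1` open_box lo hi.
Proof.
apply/seteqP; split=> [_ [y yb <-]|x xb].
  by rewrite /= -mulmxA box_frame_orth mulmx1.
by exists (x *m M^T) => //; rewrite -mulmxA frame_tr_orth mulmx1.
Qed.

Lemma preimage_box_set : (fun y => y *m M) @^-1` box_set B = open_box lo hi.
Proof.
by rewrite box_setE; apply/seteqP; split=> y /=; rewrite -mulmxA box_frame_orth mulmx1.
Qed.

Lemma measurable_box_set : measurable (box_set B).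
Proof.
by rewrite box_setE; apply: measurable_preimageT; [exact: measurable_mulmx|exact: measurable_open_box].
Qed.

Lemma volumeE : volume B = (\prod_i edge B i)%:E.
Proof.
rewrite /volume box_setE lebesgue_rV_orth ?trmxK ?frame_tr_orth//.
  by rewrite lebesgue_open_box//; exact: box_lo_lt_hi.
exact: measurable_open_box.
Qed.

Lemma integrable_box_set (f : 'rV[R]_n -> R) : continuous f ->
  (lebesgue_rV n).-integrable (box_set B) (EFin \o f).
Proof.
move=> cf.
have cfM : continuous (fun y : 'rV[R]_n => f (y *m M)).
  move=> y; apply: (@continuous_comp _ _ _ (fun y : 'rV[R]_n => y *m M) f); last exact: cf.
  exact: continuous_mulmx.
have [C HC] := bounded_closed_box (@box_lo_lt_hi _ _ B) (fun y _ => cfM y).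
apply: measurable_bounded_integrable => //.
- exact: measurable_box_set.
- by rewrite [X in (X < _)%E]volumeE ltry.
- apply: (@measurable_funS _ _ _ _ setT) => //.
  apply: continuous_measurable_rV; first exact: openT.
  by move=> x _; exact: cf.
- exists C; split; first exact: num_real.
  move=> r Cr _ /= [y yb <-]; apply: le_trans (ltW Cr); apply: HC.
  exact: open_closed_box.
Qed.

Lemma Rintegral_box_set (f : 'rV[R]_n -> R) : continuous f ->
  \int[lebesgue_rV n]_(x in box_set B) f x =
  \int[lebesgue_rV n]_(y in open_box lo hi) f (y *m M).
Proof.
move=> cf; rewrite /Rintegral; congr fine.
rewrite (integral_rV_orth (box_frame_orth B) measurable_box_set) ?preimage_box_set//.
  apply/measurable_EFinP; apply: continuous_measurable_rV; first exact: openT.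
  by move=> x _; exact: cf.
apply: (@integrable_open_box _ _ _ _ (fun y => f (y *m M))) => [|y _].
  exact: box_lo_lt_hi.
apply: (@continuous_comp _ _ _ (fun y : 'rV[R]_n => y *m M) f); last exact: cf.
exact: continuous_mulmx.
Qed.

Lemma integral_fin_Rintegral d (T : measurableType d) (mu : {measure set T -> \bar R})
    (D : set T) (f : T -> R) : measurable D -> mu.-integrable D (EFin \o f) ->
  (\int[mu]_(x in D) (f x)%:E)%E = (\int[mu]_(x in D) f x)%:E.
Proof. by move=> mD intf; rewrite /Rintegral fineK//; exact: integrable_fin_num. Qed.

Lemma L2sq_box_set (f : 'rV[R]_n -> R) : continuous f ->
  L2sq (box_set B) f = (\int[lebesgue_rV n]_(y in open_box lo hi) (f (y *m M) ^+ 2))%:E.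
Proof.
move=> cf; rewrite /L2sq.
have cf2 : continuous (fun x : 'rV[R]_n => f x ^+ 2) by move=> x; apply: cont_ptX2; exact: cf.
rewrite (integral_fin_Rintegral measurable_box_set (integrable_box_set cf2)).
by rewrite Rintegral_box_set.
Qed.

End box_geometry.

Section box_energy.
Context {R : realType} (m : nat) (B : box R m.+1).
Local Notation M := (box_frame B).
Local Notation lo := (box_lo B).
Local Notation hi := (box_hi B).

Lemma bdryL2sqE (f : 'rV[R]_m.+1 -> R) : continuous f ->
  bdryL2sq B f = (\sum_j
   (\int[lebesgue_rV m]_(z in open_box (col' j lo) (col' j hi))
      (f (rV_insert j (hi ord0 j : measurableTypeR R, z) *m M) ^+ 2) +
    \int[lebesgue_rV m]_(z in open_box (col' j lo) (col' j hi))
      (f (rV_insert j (lo ord0 j : measurableTypeR R, z) *m M) ^+ 2)))%:E.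
Proof.
move=> cf; rewrite /bdryL2sq /boundary_integral -sumEFin; apply: eq_bigr => j _.
have iface (c : R) : (lebesgue_rV m).-integrable (open_box (col' j lo) (col' j hi))
    (EFin \o (fun z => f (rV_insert j (c : measurableTypeR R, z) *m M) ^+ 2)).
  apply: integrable_open_box => [i|z _]; first by rewrite !mxE box_lo_lt_hi.
  apply: cont_ptX2.
  apply: (@continuous_comp _ _ _
    (fun z : 'rV[R]_m => rV_insert j (c : measurableTypeR R, z) *m M) f); last exact: cf.
  apply: (@continuous_comp _ _ _
    (fun z : 'rV[R]_m => rV_insert j (c : measurableTypeR R, z))
    (fun y : 'rV[R]_m.+1 => y *m M)).
    exact: rV_insert_continuous_face.
  exact: continuous_mulmx.
have mF := @measurable_open_box R _ (col' j lo) (col' j hi).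
by rewrite big_bool EFinD -!(integral_fin_Rintegral mF (iface _)).
Qed.

(** The gradients in the two frames correspond by an orthogonal matrix. *)
Lemma gradient_sq_frame (f : 'rV[R]_m.+1 -> R) y : C1 f ->
  \sum_i partial i f (y *m M) ^+ 2 = \sum_j partial j (fun y => f (y *m M)) y ^+ 2.
Proof.
move=> [df _].
pose p : 'cV[R]_m.+1 := \col_i partial i f (y *m M).
have pE (q : 'cV[R]_m.+1) : \sum_i q i ord0 ^+ 2 = (q^T *m q) ord0 ord0.
  by rewrite mxE; apply: eq_bigr => i _; rewrite mxE expr2.
transitivity ((p^T *m p) ord0 ord0).
  by rewrite -pE; apply: eq_bigr => i _; rewrite mxE.
transitivity (((M *m p)^T *m (M *m p)) ord0 ord0).
  by rewrite trmx_mul mulmxA -(mulmxA p^T) frame_tr_orth mulmx1.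
rewrite -pE; apply: eq_bigr => j _; congr (_ ^+ 2).
by rewrite mxE partial_mulmx//; apply: eq_bigr => i _; rewrite mxE.
Qed.

(** In the frame of the box, the sum over the edges of
    [coordinate_energy_identity]. *)
Lemma box_energy_identity (f : 'rV[R]_m.+1 -> R) alpha (lam : 'I_m.+1 -> R)
    (phi dphi : 'I_m.+1 -> R -> R) : C1 f ->
  (forall j, robin_mode alpha (edge B j) (lam j) (phi j) (dphi j)) ->
  \int[lebesgue_rV m.+1]_(x in box_set B) (\sum_i partial i f x ^+ 2) +
  alpha * fine (bdryL2sq B f) - (\sum_j lam j) * fine (L2sq (box_set B) f) =
  \sum_j \int[lebesgue_rV m.+1]_(y in open_box lo hi)
    ((partial j (fun y => f (y *m M)) y -
      dphi j (y ord0 j - lo ord0 j) / phi j (y ord0 j - lo ord0 j) * f (y *m M)) ^+ 2).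
Proof.
move=> C1f modes; have cf := C1_continuous C1f.
have C1G := C1_mulmx M C1f; have cG := C1_continuous C1G.
rewrite L2sq_box_set// bdryL2sqE//= Rintegral_box_set; last first.
  move=> x; apply: (@cvg_big_sum _ _ _ (nbhs_filter x)) => i.
  by apply: cont_ptX2; exact: C1f.2.
under eq_Rintegral do rewrite gradient_sq_frame//.
have mB := @measurable_open_box R _ lo hi.
have lohi := @box_lo_lt_hi _ _ B.
have -> : \int[lebesgue_rV m.+1]_(y in open_box lo hi) (\sum_j partial j (fun y => f (y *m M)) y ^+ 2) =
  \sum_j \int[lebesgue_rV m.+1]_(y in open_box lo hi) (partial j (fun y => f (y *m M)) y ^+ 2).
  have ij j : (lebesgue_rV m.+1).-integrable (open_box lo hi)
     (EFin \o (fun y => partial j (fun y => f (y *m M)) y ^+ 2)).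
    by apply: integrable_open_box => // y _; apply: cont_ptX2; exact: C1G.2.
  exact: Rintegral_sum.
rewrite mulr_sumr mulr_suml -big_split -sumrB/=; apply: eq_bigr => j _.
rewrite -(coordinate_energy_identity lohi (modes j) _ cG (C1G.2 j))//.
by move=> y; exact: C1_is_derive.
Qed.

End box_energy.

(** * The first eigenvalue of a box *)

Section robin_eigenvalue.
Context {R : realType} (m : nat) (B : box R m.+1) (alpha : R)
  (lam : 'I_m.+1 -> R) (phi dphi : 'I_m.+1 -> R -> R).
Context (modes :
  forall j, robin_mode alpha (edge B j) (lam j) (phi j) (dphi j)).
Local Notation M := (box_frame B).
Local Notation lo := (box_lo B).
Local Notation hi := (box_hi B).
Local Notation nu := (lebesgue_rV m.+1).

Lemma C1_robin_bound (f : 'rV[R]_m.+1 -> R) : C1 f ->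
  0 <= \int[nu]_(x in box_set B) (\sum_i partial i f x ^+ 2) +
  alpha * fine (bdryL2sq B f) - (\sum_j lam j) * fine (L2sq (box_set B) f).
Proof.
move=> C1f; rewrite (box_energy_identity C1f modes) sumr_ge0// => j _.
by apply: Rintegral_ge0 => y _; exact: sqr_ge0.
Qed.

Lemma measurable_funT_rV n (D : set 'rV[R]_n) (f : 'rV[R]_n -> R) :
  measurable D -> continuous f -> measurable_fun D f.
Proof.
move=> mD cf; apply: (@measurable_funS _ _ _ _ setT) => //.
by apply: continuous_measurable_rV; [exact: openT|move=> x _; exact: cf].
Qed.

Lemma continuous_in_L2 (f : 'rV[R]_m.+1 -> R) : continuous f -> in_L2 (box_set B) f.
Proof.
move=> cf; split; last by rewrite L2sq_box_set// ltry.
by apply: measurable_funT_rV => //; exact: measurable_box_set.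
Qed.

Lemma Rintegral_sum_sq (g : 'I_m.+1 -> 'rV[R]_m.+1 -> R) :
  (forall i, in_L2 (box_set B) (g i)) ->
  \int[nu]_(x in box_set B) (\sum_i g i x ^+ 2) =
  \sum_i \int[nu]_(x in box_set B) (g i x ^+ 2).
Proof.
move=> gL2; rewrite Rintegral_sum//; first exact: measurable_box_set.
move=> i; have [mg gy] := gL2 i; apply: integrable_sq => //.
exact: measurable_box_set.
Qed.

(** The contribution of one face, indexed by its edge direction and its side, to
    the boundary norm; convergence of traces is used face by face. *)
Definition face_sq (p : 'I_m.+1 * bool) (f : 'rV[R]_m.+1 -> R) : \bar R :=
  (\int[lebesgue_rV m]_(z in face_dom B p.1) ((f (face_point B p.1 p.2 z)) ^+ 2)%:E)%E.

Lemma face_sq_ge0 p f : (0 <= face_sq p f)%E.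
Proof. by apply: integral_ge0 => z _; rewrite lee_fin sqr_ge0. Qed.

Lemma bdryL2sq_faces f : bdryL2sq B f = (\sum_p face_sq p f)%E.
Proof. by rewrite /bdryL2sq /boundary_integral pair_bigA. Qed.

Lemma face_sq_le p f : (face_sq p f <= bdryL2sq B f)%E.
Proof.
rewrite bdryL2sq_faces (bigD1 p)//= leeDl// sume_ge0// => q _.
exact: face_sq_ge0.
Qed.

Lemma fine_bdryL2sq f : (bdryL2sq B f < +oo)%E ->
  fine (bdryL2sq B f) = \sum_p fine (face_sq p f).
Proof.
move=> fy; rewrite sum_fine -?bdryL2sq_faces// => p _.
by rewrite ge0_fin_numE ?face_sq_ge0//; exact: le_lt_trans (face_sq_le p f) fy.
Qed.

Lemma bdryL2sq_lty f : continuous f -> (bdryL2sq B f < +oo)%E.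
Proof. by move=> cf; rewrite bdryL2sqE// ltry. Qed.

Lemma continuous_face_point j s : continuous (face_point B j s).
Proof.
move=> z; apply: (@continuous_comp _ _ _ (fun z : 'rV[R]_m =>
  rV_insert j ((if s then hi else lo) ord0 j : measurableTypeR R, z)) (fun y : 'rV[R]_m.+1 => y *m M)).
  exact: rV_insert_continuous_face.
exact: continuous_mulmx.
Qed.

Lemma measurable_face_point j s : measurable_fun setT (face_point B j s).
Proof.
apply: (@measurable_comp _ _ _ _ _ _ setT (fun y : 'rV[R]_m.+1 => y *m M) _ (fun z : 'rV[R]_m =>
  rV_insert j ((if s then hi else lo) ord0 j : measurableTypeR R, z))) => //.
  exact: measurable_mulmx.
exact: (measurable_fun_pair2 _ (measurable_rV_insert j)).
Qed.

(** The bound for the C1 functions that define the trace passes to the limit, as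
    each term of the Robin form is a squared L2 norm. *)
Lemma H1_robin_bound u g t : in_H1 (box_set B) u g -> is_trace B u g t ->
  0 <= \int[nu]_(x in box_set B) (\sum_i g i x ^+ 2) +
  alpha * fine (bdryL2sq B t) - (\sum_j lam j) * fine (L2sq (box_set B) u).
Proof.
move=> [[mu uy] gL2 _] [mt ty [v [C1v vu vg vt]]].
have cv k := C1_continuous (C1v k).
have mB := measurable_box_set B.
have vL2 k := continuous_in_L2 (cv k).
have pvL2 k i : in_L2 (box_set B) (partial i (v k)).
  by apply: continuous_in_L2; exact: (C1v k).2.
have cvu : \int[nu]_(x in box_set B) (v k x ^+ 2) @[k --> \oo] --> fine (L2sq (box_set B) u).
  exact: (L2_norm_cvg mB mu (fun k => (vL2 k).1) uy (fun k => (vL2 k).2) vu).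
have cvg i : \int[nu]_(x in box_set B) (partial i (v k) x ^+ 2) @[k --> \oo] -->
    \int[nu]_(x in box_set B) (g i x ^+ 2).
  have [mg gy] := gL2 i.
  exact: (L2_norm_cvg mB mg (fun k => (pvL2 k i).1) gy (fun k => (pvL2 k i).2) (vg i)).
have cvt p : fine (face_sq p (v k)) @[k --> \oo] --> fine (face_sq p t).
  have mD : measurable (face_dom B p.1) by exact: measurable_open_box.
  apply: L2_norm_cvg => //.
  - apply: (@measurable_funS _ _ _ _ setT) => //.
    exact: (measurableT_comp mt (measurable_face_point _ _)).
  - move=> k; apply: measurable_funT_rV => // z.
    by apply: (@continuous_comp _ _ _ (face_point B p.1 p.2) (v k)); [exact: continuous_face_point|exact: cv].
  - exact: le_lt_trans (face_sq_le p t) ty.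
  - by move=> k; exact: le_lt_trans (face_sq_le p (v k)) (bdryL2sq_lty (cv k)).
  - apply: (squeeze_cvge _ (cvg_cst 0%E) vt).
    by apply: nearW => k; rewrite (face_sq_ge0 p (fun x => v k x - t x))
      (face_sq_le p (fun x => v k x - t x)).
pose Q k := \sum_i \int[nu]_(x in box_set B) (partial i (v k) x ^+ 2) +
  alpha * (\sum_p fine (face_sq p (v k))) -
  (\sum_j lam j) * \int[nu]_(x in box_set B) (v k x ^+ 2).
rewrite Rintegral_sum_sq// fine_bdryL2sq//.
set q := _ - _; have Qq : Q k @[k --> \oo] --> q.
  apply: cvgB; last by apply: cvgM; [exact: cvg_cst|exact: cvu].
  apply: cvgD; first exact: cvg_big_sum.
  by apply: cvgM; [exact: cvg_cst|exact: cvg_big_sum].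
rewrite -(cvg_lim _ Qq)//; apply: limr_ge; first by apply/cvg_ex; exists q.
apply: nearW => k; have := C1_robin_bound (C1v k).
by rewrite Rintegral_sum_sq// fine_bdryL2sq//; exact: bdryL2sq_lty.
Qed.

(** The minimizer in the coordinates of the edges, obtained by separation of
    variables. *)
Definition product_mode (y : 'rV[R]_m.+1) : R :=
  \prod_i phi i (y ord0 i - lo ord0 i).

Definition box_mode (x : 'rV[R]_m.+1) : R := product_mode (x *m M^T).

Lemma C1_product_mode : C1 product_mode.
Proof.
apply: C1_prod => i; have [d dd _ _ _] := modes i.
apply: C1_coord d _ => s; exact: (derive_continuous (dd s)).
Qed.

Lemma C1_box_mode : C1 box_mode.
Proof. exact: (C1_mulmx M^T C1_product_mode). Qed.

Lemma box_mode_frame y : box_mode (y *m M) = product_mode y.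
Proof. by rewrite /box_mode -mulmxA box_frame_orth mulmx1. Qed.

(** The other factors are constant along the direction [j]. *)
Lemma partial_product_mode j y : partial j product_mode y =
  dphi j (y ord0 j - lo ord0 j) * \prod_(i | i != j) phi i (y ord0 i - lo ord0 i).
Proof.
have [d _ _ _ _] := modes j.
pose V (y : 'rV[R]_m.+1) := \prod_(i | i != j) phi i (y ord0 i - lo ord0 i).
have HV (h : R) : V (h *: delta_mx ord0 j + y) = h *: (0 : R) + V y.
  rewrite scaler0 add0r; apply: eq_bigr => i ij.
  by rewrite !mxE eqxx (negbTE ij) mulr0 add0r.
have dV : is_derive y (delta_mx ord0 j) V 0.
  by apply: (is_derive_line id (q := V) 0 HV).1; exact: is_derive0.
have -> : product_mode = (fun y => phi j (y ord0 j - lo ord0 j) * V y).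
  by apply/funext => z; rewrite /product_mode (bigD1 j).
have [_ H] := is_deriveM (is_derive_coord (d (y ord0 j - lo ord0 j))) dV.
by rewrite /partial [LHS]H scaler0 add0r [LHS]mulrC.
Qed.

Lemma product_mode_gt0 y : closed_box lo hi y -> 0 < product_mode y.
Proof.
move=> yb; apply: prodr_gt0 => i _; have [_ _ + _ _] := modes i; apply.
by have := yb i; rewrite subr_ge0 lerD2r.
Qed.

(** The product of the modes satisfies [dG = w G] in each edge direction, so all
    squares in [box_energy_identity] vanish. *)
Lemma box_mode_energy :
  \int[nu]_(x in box_set B) (\sum_i partial i box_mode x ^+ 2) +
  alpha * fine (bdryL2sq B box_mode) = (\sum_j lam j) * fine (L2sq (box_set B) box_mode).
Proof.
apply/eqP; rewrite -subr_eq0 (box_energy_identity C1_box_mode modes); apply/eqP.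
apply: big1 => j _.
have -> : (fun y => box_mode (y *m M)) = product_mode by apply/funext => y; exact: box_mode_frame.
rewrite -[RHS](_ : \int[nu]_(y in open_box lo hi) 0 = 0); last by rewrite /Rintegral integral0.
apply: eq_Rintegral => y /set_mem yb.
have U : product_mode y = phi j (y ord0 j - lo ord0 j) *
    \prod_(i | i != j) phi i (y ord0 i - lo ord0 i) by exact: bigD1.
rewrite box_mode_frame partial_product_mode U.
have [_ _ p0 _ _] := modes j.
have yj : 0 < phi j (y ord0 j - lo ord0 j).
  by apply: p0; have := open_closed_box yb j; rewrite subr_ge0 lerD2r.
move: yj; set a := phi j _; set b := dphi j _; set c := \prod_(_ | _) _ => a0.
have -> : b / a * (a * c) = b * c by field; rewrite gt_eqF.
by rewrite subrr expr0n.
Qed.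

Lemma L2sq_box_mode_gt0 : (0 < L2sq (box_set B) box_mode)%E.
Proof.
rewrite L2sq_box_set; last exact: (C1_continuous C1_box_mode).
under eq_Rintegral do rewrite box_mode_frame.
have lohi := @box_lo_lt_hi _ _ B.
have cU : continuous (fun y => product_mode y ^+ 2).
  by move=> y; apply: cont_ptX2; exact: (C1_continuous C1_product_mode).
have [||c /set_mem cb cmin] := @EVT_min_rV R m.+1 (fun y => product_mode y ^+ 2) _ _
  (@compact_closed_box R _ lo hi).
- by exists lo => i; rewrite lexx ltW.
- exact: continuous_subspaceT.
have mB := @measurable_open_box R _ lo hi.
have c0 : 0 < product_mode c ^+ 2 by rewrite exprn_gt0// product_mode_gt0.
rewrite lte_fin; apply: (@lt_le_trans _ _ (\int[nu]_(y in open_box lo hi) (product_mode c ^+ 2))).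
  rewrite Rintegral_cst// mulr_gt0// [X in fine X](lebesgue_open_box lohi)/=.
  by apply: prodr_gt0 => i _; rewrite subr_gt0.
apply: le_Rintegral => //.
- by apply: integrable_open_box => // y _; exact: cst_continuous.
- by apply: integrable_open_box => // y _; exact: cU.
- by move=> y yb; apply: cmin; apply/mem_set; exact: open_closed_box.
Qed.

(** The divergence theorem in each edge direction; a function vanishing outside of
    the open box vanishes on its faces. *)
Lemma Rintegral_partial_eq0 (P : 'rV[R]_m.+1 -> R) i : C1 P ->
  (forall x, ~ box_set B x -> P x = 0) ->
  \int[nu]_(x in box_set B) partial i P x = 0.
Proof.
move=> C1P P0; rewrite Rintegral_box_set; last exact: C1P.2.
have C1G := C1_mulmx M C1P.
have lohi := @box_lo_lt_hi _ _ B.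
have mB := @measurable_open_box R _ lo hi.
have E y : partial i P (y *m M) = \sum_j M j i * partial j (fun y => P (y *m M)) y.
  pose p : 'cV[R]_m.+1 := \col_k partial k P (y *m M).
  transitivity ((M^T *m (M *m p)) i ord0).
    by rewrite mulmxA frame_tr_orth mul1mx mxE.
  rewrite mxE.
  apply: eq_bigr => j _; rewrite mxE; congr (_ * _).
  rewrite partial_mulmx; last exact: C1P.1.
  by rewrite mxE; apply: eq_bigr => k _; rewrite mxE.
under eq_Rintegral do rewrite E.
have ip j : nu.-integrable (open_box lo hi) (EFin \o (partial j (fun y => P (y *m M)))).
  by apply: integrable_open_box => // y _; exact: C1G.2.
rewrite Rintegral_sum//; last by move=> j; exact: (integrableZl mB (M j i) (ip j)).
apply: big1 => j _; rewrite RintegralZl//.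
rewrite (@divergence_box _ _ _ _ j _ _ lohi (fun y _ => C1_is_derive j y C1G)
  (fun y _ => C1G.2 j y)).
have H c z : ~ (lo ord0 j < c < hi ord0 j) -> P (rV_insert j (c : measurableTypeR R, z) *m M) = 0.
  move=> cj; apply: P0 => yb; apply: cj.
  have : open_box lo hi (rV_insert j (c : measurableTypeR R, z)) by rewrite -preimage_box_set.
  by move/open_box_insert => [].
rewrite -[X in _ * X](_ : \int[lebesgue_rV m]_(z in open_box (col' j lo) (col' j hi)) 0 = _).
  by rewrite /Rintegral integral0 mulr0.
by apply: eq_Rintegral => z _; rewrite !H ?ltxx ?andbF ?subrr.
Qed.

Lemma box_mode_H1 : in_H1 (box_set B) box_mode (fun i => partial i box_mode).
Proof.
have C1u := C1_box_mode.
split.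
- exact/continuous_in_L2/C1_continuous.
- by move=> i; apply: continuous_in_L2; exact: C1u.2.
move=> i psi [C1psi [K [_ KB K0]]].
have mB := measurable_box_set B.
have cu := C1_continuous C1u; have cpsi := C1_continuous C1psi.
have i1 : nu.-integrable (box_set B) (EFin \o (fun x => box_mode x * partial i psi x)).
  by apply: integrable_box_set => x; apply: cont_ptM; [exact: cu|exact: C1psi.2].
have i2 : nu.-integrable (box_set B) (EFin \o (fun x => partial i box_mode x * psi x)).
  by apply: integrable_box_set => x; apply: cont_ptM; [exact: C1u.2|exact: cpsi].
apply/eqP; rewrite -addr_eq0 -(RintegralD mB i1 i2); apply/eqP.
rewrite -[RHS](@Rintegral_partial_eq0 (fun x => box_mode x * psi x) i); last 2 first.
- exact: C1M.
- by move=> x xB; rewrite K0 ?mulr0// => Kx; apply: xB; exact: KB.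
by apply: eq_Rintegral => x _; rewrite partialM// (mulrC (psi x)).
Qed.

Lemma L2sq_sub_self (D : set 'rV[R]_m.+1) (f : 'rV[R]_m.+1 -> R) :
  L2sq D (fun x => f x - f x) = 0%E.
Proof. by rewrite /L2sq integral0_eq// => x _; rewrite subrr expr0n. Qed.

Lemma box_mode_trace : is_trace B box_mode (fun i => partial i box_mode) box_mode.
Proof.
have C1u := C1_box_mode; have cu := C1_continuous C1u.
split; [exact: measurable_funT_rV|exact: bdryL2sq_lty|exists (fun=> box_mode)].
split => //.
- by rewrite L2sq_sub_self; exact: cvg_cst.
- by move=> i; rewrite L2sq_sub_self; exact: cvg_cst.
- rewrite (_ : bdryL2sq B _ = 0%E); first exact: cvg_cst.
  rewrite bdryL2sq_faces big1// => p _; rewrite /face_sq integral0_eq// => z _.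
  by rewrite subrr expr0n.
Qed.

(** Separation of variables: [box_mode] attains the bound of [H1_robin_bound]. *)
Lemma lambda1_box : lambda1 B alpha = \sum_j lam j.
Proof.
have fin_gt0 u : in_L2 (box_set B) u -> L2sq (box_set B) u != 0%E ->
    0 < fine (L2sq (box_set B) u).
  move=> [_ uy] u0.
  have ge0 : (0 <= L2sq (box_set B) u)%E.
    by apply: integral_ge0 => x _; rewrite lee_fin sqr_ge0.
  by rewrite fine_gt0// uy lt0e u0 ge0.
have mem : robin_quotients B alpha (\sum_j lam j).
  exists box_mode, (fun i => partial i box_mode), box_mode; split.
  - exact: box_mode_H1.
  - by rewrite gt_eqF// L2sq_box_mode_gt0.
  - exact: box_mode_trace.
  - rewrite /robin_quotient box_mode_energy mulfK// gt_eqF//.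
    by apply: fin_gt0; [have [] := box_mode_H1|rewrite gt_eqF// L2sq_box_mode_gt0].
have low : lbound (robin_quotients B alpha) (\sum_j lam j).
  move=> _ [u [g [t [uH1 u0 tr ->]]]].
  have [uL2 _ _] := uH1.
  by rewrite /robin_quotient ler_pdivlMr ?fin_gt0// -subr_ge0; exact: H1_robin_bound uH1 tr.
rewrite /lambda1; apply: xget_unique => // l [lm ll].
by apply: le_anti; rewrite ll// low.
Qed.

End robin_eigenvalue.

(** * A tangent line inequality *)

Section tangent_inequality.
Context {R : realType}.

Lemma mean_value (f df : R -> R) a b : a < b ->
  (forall x : R, a <= x <= b -> is_derive x 1 f (df x)) ->
  exists2 c, a < c < b & f b - f a = df c * (b - a).
Proof.
move=> ab dfE; have [||c cab E] := @MVT R f df a b ab.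
- by move=> x; rewrite in_itv/= => /andP[/ltW ax /ltW xb]; apply: dfE; rewrite ax.
- apply: continuous_in_subspaceT => x /set_mem; rewrite /= in_itv/= => xab.
  exact: derive_continuous (dfE x xab).
by exists c => //; move: cab; rewrite in_itv.
Qed.

Lemma is_derive_pow k (t : R) : is_derive t 1 (fun t : R => t ^+ k) (k%:R * t ^+ k.-1).
Proof.
have H := is_deriveX k (is_derive_id t (1 : R)).
have -> : (fun t : R => t ^+ k) = (id : R -> R) ^+ k by apply/funext => s; rewrite fctE.
by apply: is_derive_eq H _; rewrite /GRing.scale/= mulr1.
Qed.

Context (sigma : R) (E : R -> R).

(** The parameters [x] at which [E] is defined: the half-line for [sigma = 1], and
    the interval ]0, 1[ for [sigma = - 1]. *)
Definition admissible (x : R) := 0 < x /\ 0 < 1 + sigma * x ^+ 2.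

Context (E0 : E 0 = 0) (dE : forall x : R, 0 <= x -> 0 < 1 + sigma * x ^+ 2 ->
  is_derive x 1 E (1 + sigma * x ^+ 2)^-1).

Lemma admissible_le x y : 0 <= y -> y <= x -> admissible x -> 0 < 1 + sigma * y ^+ 2.
Proof.
move=> y0 yx [x0 Dx].
have yx2 : y ^+ 2 <= x ^+ 2 by rewrite ler_sqr ?nnegrE// ltW.
have y2 := sqr_ge0 y.
have [s0|s0] := leP 0 sigma; first by rewrite ltr_wpDr// mulr_ge0.
by apply: (lt_le_trans Dx); rewrite lerD2l ler_wnM2l// ltW.
Qed.

Lemma E_mean x : admissible x -> exists2 xi, 0 < xi < x & E x = x / (1 + sigma * xi ^+ 2).
Proof.
move=> Dx; have [x0 _] := Dx.
have [y|c c0x] := mean_value (f := E) (df := fun y => (1 + sigma * y ^+ 2)^-1) x0.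
  by move=> /andP[y0 yx]; apply: dE => //; exact: admissible_le Dx.
by rewrite E0 !subr0 => ->; exists c => //; rewrite mulrC.
Qed.

Lemma E_gt0 x : admissible x -> 0 < E x.
Proof.
move=> Dx; have [xi /andP[xi0 xix] ->] := E_mean Dx; have [x0 _] := Dx.
by rewrite divr_gt0// (admissible_le (ltW xi0) (ltW xix) Dx).
Qed.

(** Up to a constant factor, the inverse of minus the derivative of [x ^ -2] with
    respect to [ln (x E(x))]. The second term is written as an inverse because its
    inverse [(1 + sigma x ^ 2) E(x) / x ^ 3] has the simpler derivative. *)
Definition slope_ratio x := x ^+ 2 + ((1 + sigma * x ^+ 2) * E x / x ^+ 3)^-1.

(** The derivative of [(1 + sigma x ^ 2) E(x) / x ^ 3] has the sign of
    [x - (3 + sigma x ^ 2) E(x)], and by the mean value theorem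
    [E(x) = x / (1 + sigma xi ^ 2)] with [0 < xi < x], where
    [1 + sigma xi ^ 2 < 3 + sigma x ^ 2]. *)
Lemma slope_ratio_incr x y : admissible x -> admissible y -> x < y ->
  slope_ratio x < slope_ratio y.
Proof.
move=> Dx Dy xy; have [x0 _] := Dx; have [y0 _] := Dy.
pose K (t : R) := (1 + sigma * t ^+ 2) * E t / t ^+ 3.
pose dK (t : R) := (t - (3 + sigma * t ^+ 2) * E t) / t ^+ 4.
have K0 t : admissible t -> 0 < K t.
  by move=> Dt; have [t0 t1] := Dt; rewrite divr_gt0 ?exprn_gt0// mulr_gt0// E_gt0.
have dKE (t : R) : x <= t <= y -> is_derive t 1 K (dK t).
  move=> /andP[xt ty]; have t0 : 0 < t by exact: lt_le_trans xt.
  have Dt : 0 < 1 + sigma * t ^+ 2 by apply: admissible_le Dy => //; exact: ltW.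
  have dEt := dE (ltW t0) Dt.
  have t3 : (fun t : R => t ^+ 3) t != 0 by rewrite gt_eqF// exprn_gt0.
  have dt3 := is_derive_pow 3 t.
  have dp := is_deriveD (is_derive_cst (1 : R) t 1) (is_deriveZ sigma (is_derive_pow 2 t)).
  have H := is_deriveM (is_deriveM dp dEt) (@is_deriveV _ (fun t : R => t ^+ 3) t _ 1 t3 dt3).
  apply: is_derive_eq H _; rewrite /GRing.scale/= /dK.
  transitivity ((1 + sigma * t ^+ 2) * E t * (- ((t ^+ 3) ^+ 2)^-1 * (3 * t ^+ 2)) +
    (t ^+ 3)^-1 * ((1 + sigma * t ^+ 2) / (1 + sigma * t ^+ 2) + E t * (0 + sigma * (2 * t)))) => //.
  by field; rewrite !gt_eqF.
have [c /andP[xc cy] HK] := mean_value xy dKE.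
have c0 : 0 < c by exact: lt_trans xc.
have Dc : admissible c.
  by split=> //; apply: admissible_le Dy; exact: ltW.
have dKc : dK c < 0.
  have [xi /andP[xi0 xic] Ec] := E_mean Dc.
  have Dxi : 0 < 1 + sigma * xi ^+ 2 by apply: admissible_le Dc; exact: ltW.
  rewrite /dK pmulr_llt0 ?invr_gt0 ?exprn_gt0// subr_lt0 Ec mulrCA ltr_pMr// ltr_pdivlMr// mul1r.
  have xic2 : xi ^+ 2 <= c ^+ 2 by rewrite ler_sqr ?nnegrE// ltW.
  have [s0|s0] := leP 0 sigma.
    rewrite ltr_leD//; first by lra.
    by rewrite ler_wpM2l.
  have [_ Dc2] := Dc; have := sqr_ge0 xi => xi2.
  have : sigma * xi ^+ 2 <= 0 by rewrite nmulr_rle0.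
  lra.
rewrite /slope_ratio -/(K x) -/(K y) ltr_leD//.
  by rewrite ltr_sqr ?nnegrE// ltW.
rewrite lef_pV2 ?posrE ?K0// ltW//.
by rewrite -subr_lt0 HK nmulr_rlt0// subr_gt0.
Qed.

Lemma slope_ratio_gt0 x : admissible x -> 0 < slope_ratio x.
Proof.
move=> Dx; have [x0 x1] := Dx; rewrite addr_gt0 ?exprn_gt0//.
by rewrite invr_gt0 divr_gt0 ?exprn_gt0// mulr_gt0// E_gt0.
Qed.

(** Strict convexity of [x ^ -2] as a function of [ln (x E(x))], in the form of the
    tangent line inequality: the difference of the two sides is a function of [x]
    whose derivative has the sign of [slope_ratio x - slope_ratio x0]. *)
Lemma tangent_log x0 x : admissible x0 -> admissible x -> x != x0 ->
  (x0 ^+ 2)^-1 - 2 / slope_ratio x0 * (ln (x * E x) - ln (x0 * E x0)) < (x ^+ 2)^-1.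
Proof.
move=> Dx0 Dx xx0; set c := 2 / slope_ratio x0.
have S0 := slope_ratio_gt0 Dx0.
pose G (t : R) := (t ^+ 2)^-1 + c * ln (t * E t).
pose dG (t : R) := (c * slope_ratio t - 2) / t ^+ 3.
have dGE (t : R) : admissible t -> is_derive t 1 G (dG t).
  move=> Dt; have [t0 t1] := Dt; have Et := E_gt0 Dt.
  have dEt := dE (ltW t0) t1.
  have t2 : (fun t : R => t ^+ 2) t != 0 by rewrite gt_eqF// exprn_gt0.
  have dt2 := is_derive_pow 2 t.
  have dtE : is_derive t 1 (fun t : R => t * E t) (t * (1 + sigma * t ^+ 2)^-1 + E t).
    have H := is_deriveM (is_derive_id t (1 : R)) dEt.
    by apply: is_derive_eq H _; rewrite /GRing.scale/= mulr1.
  have dl : is_derive t 1 (fun t : R => ln (t * E t)) ((t * E t)^-1 * (t * (1 + sigma * t ^+ 2)^-1 + E t)).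
    by apply: (is_derive1_comp _ dtE); apply: is_derive1_ln; rewrite mulr_gt0.
  have H := is_deriveD (@is_deriveV _ (fun t : R => t ^+ 2) t _ 1 t2 dt2) (is_deriveZ c dl).
  apply: is_derive_eq H _; rewrite /GRing.scale/= /dG /slope_ratio.
  by field; rewrite !gt_eqF.
have cS t : admissible t -> (0 < c * slope_ratio t - 2) = (slope_ratio x0 < slope_ratio t).
  by move=> Dt; rewrite subr_gt0 /c mulrAC ltr_pdivlMr// ltr_pM2l.
have cS' t : admissible t -> (c * slope_ratio t - 2 < 0) = (slope_ratio t < slope_ratio x0).
  by move=> Dt; rewrite subr_lt0 /c mulrAC ltr_pdivrMr// ltr_pM2l.
suff : G x0 < G x by rewrite /G; lra.
have between a b t : admissible a -> admissible b -> a <= t <= b -> admissible t.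
  move=> [a0 _] Db /andP[at_ tb]; have t0 := lt_le_trans a0 at_.
  by split=> //; apply: admissible_le Db => //; exact: ltW.
have [xlt|xgt|xE] := ltgtP x x0; last by rewrite xE eqxx in xx0.
- have [t tb|t tb H] := mean_value (f := G) (df := dG) xlt; first exact/dGE/(between _ _ _ Dx Dx0).
  have Dt : admissible t by apply: (between _ _ _ Dx Dx0); case/andP: tb => /ltW -> /ltW ->.
  have [t0 _] := Dt.
  rewrite -subr_lt0 H nmulr_rlt0 ?subr_gt0//.
  rewrite /dG pmulr_llt0 ?invr_gt0 ?exprn_gt0// cS'// slope_ratio_incr//.
  by case/andP: tb.
- have [t tb|t tb H] := mean_value (f := G) (df := dG) xgt; first exact/dGE/(between _ _ _ Dx0 Dx).
  have Dt : admissible t by apply: (between _ _ _ Dx0 Dx); case/andP: tb => /ltW -> /ltW ->.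
  have [t0 _] := Dt.
  rewrite -subr_gt0 H mulr_gt0 ?subr_gt0//.
  rewrite /dG divr_gt0 ?exprn_gt0// cS// slope_ratio_incr//.
  by case/andP: tb.
Qed.

End tangent_inequality.

(** * The spectrum of an interval *)

Section interval_spectrum.
Context {R : realType}.

(** The function [Lam] gives the first eigenvalue of an interval in terms of its
    length. Multiplied by [sigma] it is positive and, as a function of the logarithm
    of the length, strictly above its tangent lines. *)
Definition interval_spectrum (sigma alpha : R) (Lam : R -> R) : Prop :=
  [/\ forall l, 0 < l -> exists phi dphi, robin_mode alpha l (Lam l) phi dphi,
      forall l, 0 < l -> 0 < sigma * Lam l &
      forall l0, 0 < l0 -> exists c, forall l, 0 < l -> l != l0 ->
        sigma * Lam l0 - c * (ln l - ln l0) < sigma * Lam l].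

(** The parametrization of lengths by [x E(x)] and of eigenvalues by
    [sigma alpha ^ 2 / x ^ 2] reduces the tangent line property to [tangent_log]. *)
Lemma interval_spectrum_exists (sigma alpha : R) (E : R -> R) :
  sigma * sigma = 1 -> 0 < sigma * alpha -> E 0 = 0 ->
  (forall x : R, 0 <= x -> 0 < 1 + sigma * x ^+ 2 ->
    is_derive x 1 E (1 + sigma * x ^+ 2)^-1) ->
  (forall L, 0 < L -> exists2 x, admissible sigma x & x * E x = L) ->
  (forall x l, admissible sigma x -> x * E x = sigma * alpha * l / 2 ->
    exists phi dphi, robin_mode alpha l (sigma * alpha ^+ 2 / x ^+ 2) phi dphi) ->
  exists Lam, interval_spectrum sigma alpha Lam.
Proof.
move=> ss sa E0 dE surj mode.
have L0 l : 0 < l -> 0 < sigma * alpha * l / 2 by move=> l0; rewrite divr_gt0// mulr_gt0.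
have /choice[x Hx] : forall l, exists x, 0 < l ->
    admissible sigma x /\ x * E x = sigma * alpha * l / 2.
  move=> l; have [l0|l0] := ltP 0 l; last by exists 0.
  by have [x Dx xE] := surj _ (L0 l l0); exists x.
have a2 : 0 < alpha ^+ 2.
  by rewrite lt0r sqr_ge0 andbT sqrf_eq0; apply: contraTneq sa => ->; rewrite mulr0 ltxx.
have sL l : sigma * (sigma * alpha ^+ 2 / x l ^+ 2) = alpha ^+ 2 * (x l ^+ 2)^-1.
  by rewrite !mulrA ss mul1r.
exists (fun l => sigma * alpha ^+ 2 / x l ^+ 2); split.
- by move=> l /Hx[Dx xE]; exact: mode.
- by move=> l /Hx[[x0 _] _]; rewrite sL mulr_gt0// invr_gt0 exprn_gt0.
move=> l0 l0_gt0; have [Dx0 xE0] := Hx _ l0_gt0.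
exists (alpha ^+ 2 * (2 / slope_ratio sigma E (x l0))) => l l_gt0 ll0.
have [Dx xE] := Hx _ l_gt0.
have xx0 : x l != x l0.
  apply: contra_neq ll0 => xx; move: xE; rewrite xx xE0 => /(congr1 (fun t => t * 2)).
  by rewrite !divfK// => /(mulfI (lt0r_neq0 sa)) ->.
have := tangent_log E0 dE Dx0 Dx xx0.
rewrite xE xE0 !sL.
have lnE t : 0 < t -> ln (sigma * alpha * t / 2) = ln (sigma * alpha / 2) + ln t.
  by move=> t0; rewrite mulrAC [LHS]lnM ?posrE ?divr_gt0.
rewrite !lnE// => H.
rewrite -mulrA -mulrBr ltr_pM2l//; apply: le_lt_trans H.
by rewrite opprD addrACA subrr add0r.
Qed.

Lemma atan_mul_surj (L : R) : 0 < L -> exists2 x, admissible 1 x & x * atan x = L.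
Proof.
move=> L0.
have p4 : 0 < atan (1 : R) by rewrite atan1 divr_gt0// pi_gt0.
(* As b >= 1 one has atan b >= atan 1, hence b atan b >= L. *)
pose b := 1 + L / atan 1.
have b1 : 1 <= b by rewrite lerDl divr_ge0// ltW.
have b0 : 0 < b by apply: lt_le_trans b1.
have bL : L <= b * atan b.
  apply: (@le_trans _ _ (L / atan 1 * atan 1)); first by rewrite divfK// gt_eqF.
  have ab : atan 1 <= atan b by exact: le_atan.
  by apply: ler_pM => //; [rewrite divr_ge0// ltW|exact: ltW|rewrite lerDr].
have [||c] := @IVT R (fun x => x * atan x) 0 b L (ltW b0).
- apply: continuous_subspaceT => x; apply: cont_ptM; first exact: cvg_id.
  exact: continuous_atan.
- by rewrite atan0 mulr0 ge_min le_max (ltW L0) bL orbT.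
rewrite in_itv/= => /andP[c0 _] cL; exists c => //.
have cp : 0 < c by rewrite lt0r c0 andbT; apply: contraTneq L0 => c00; rewrite -cL c00 mul0r ltxx.
by split=> //; rewrite mul1r addr_gt0// exprn_gt0.
Qed.

Lemma is_derive_affine (f : R -> R) (k c l s : R) : is_derive (k * (s - c)) 1 f l ->
  is_derive s 1 (fun s => f (k * (s - c))) (k * l).
Proof.
move=> df.
have dg : is_derive s 1 (fun s : R => k * (s - c)) k.
  have H := is_deriveZ k (is_deriveB (is_derive_id s (1 : R)) (is_derive_cst c s (1 : R))).
  by apply: is_derive_eq H _; rewrite /GRing.scale/= subr0 mulr1.
by have H := @is_derive1_comp _ f (fun s => k * (s - c)) s l k df dg; apply: is_derive_eq H _; rewrite mulrC.
Qed.

(** The mode is the cosine of frequency [alpha / x] centred at the midpoint of the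
    interval, and [x = tan (k l / 2)] expresses the boundary condition. *)
Lemma positive_spectrum (alpha : R) : 0 < alpha -> exists Lam, interval_spectrum 1 alpha Lam.
Proof.
move=> a0; apply: (@interval_spectrum_exists 1 alpha atan); rewrite ?mul1r ?atan0//.
- by move=> x _ _; rewrite mul1r; exact: is_derive1_atan.
- exact: atan_mul_surj.
move=> x l [x0 _] xl.
pose k := alpha / x; pose c := l / 2.
have k0 : 0 < k by rewrite divr_gt0.
have kc : k * c = atan x.
  apply: (mulfI (lt0r_neq0 x0)); rewrite xl /k /c; field; exact: lt0r_neq0.
have cosE : 0 < cos (atan x) by apply: cos_gt0_pihalf; rewrite atan_gtNpi2 atan_ltpi2.
have sinE : k * sin (atan x) = alpha * cos (atan x).
  have := atanK x; rewrite /tan => /(congr1 (fun t => t * cos (atan x))).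
  rewrite divfK ?gt_eqF// => ->; rewrite /k; field; exact: lt0r_neq0.
exists (fun s => cos (k * (s - c))), (fun s => - k * sin (k * (s - c))); split.
- by move=> s; rewrite mulNr -mulrN; apply: is_derive_affine; exact: is_derive_cos.
- move=> s; have H := is_deriveZ (- k) (is_derive_affine (is_derive_sin (k * (s - c)))).
  by apply: is_derive_eq H _; rewrite /GRing.scale/= /k; field; exact: lt0r_neq0.
- move=> s /andP[s0 sl]; apply: cos_gt0_pihalf.
  have h1 : k * (s - c) <= atan x by rewrite -kc ler_pM2l// /c; lra.
  have h2 : - atan x <= k * (s - c) by rewrite -kc -mulrN ler_pM2l// /c; lra.
  by rewrite (lt_le_trans _ h2) ?(le_lt_trans h1) ?atan_ltpi2// ltrN2 atan_ltpi2.
- by rewrite sub0r mulrN kc sinN cosN mulrNN.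
- have -> : l - c = c by rewrite /c; field.
  by rewrite kc mulNr sinE mulNr.
Qed.

Definition artanh (x : R) : R := (ln (1 + x) - ln (1 - x)) / 2.

Lemma expR_artanh (x : R) : 0 <= x -> x < 1 ->
  expR (artanh x) = (1 + x) / (1 - x) * expR (- artanh x).
Proof.
move=> x0 x1.
have p1 : 0 < 1 + x by lra.
have p2 : 0 < 1 - x by lra.
rewrite -[(1 + x) / _](@lnK R) ?posrE ?divr_gt0// -expRD ln_div ?posrE//.
by congr expR; rewrite /artanh; field.
Qed.

(** The relation [tanh (artanh x) = x] without division. *)
Lemma tanh_pair (x : R) : 0 <= x -> x < 1 ->
  expR (artanh x) - expR (- artanh x) = x * (expR (artanh x) + expR (- artanh x)).
Proof.
move=> x0 x1; rewrite expR_artanh//; field; lra.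
Qed.

Lemma admissibleN1 (x : R) : admissible (- 1) x <-> 0 < x < 1.
Proof.
rewrite /admissible mulN1r subr_gt0; split=> [[x0 x1]|/andP[x0 x1]].
  by rewrite x0 -(@ltr_sqr _ x 1) ?nnegrE ?expr1n// ltW.
by split=> //; rewrite -(expr1n _ 2) ltr_sqr ?nnegrE// ltW.
Qed.

Lemma is_derive_artanh (x : R) : 0 <= x -> 0 < 1 + - 1 * x ^+ 2 ->
  is_derive x 1 artanh (1 + - 1 * x ^+ 2)^-1.
Proof.
move=> x0 x2.
have x1 : x < 1 by move: x2; rewrite mulN1r subr_gt0 -{1}(expr1n _ 2) ltr_sqr ?nnegrE.
have p1 : 0 < 1 + x by lra.
have p2 : 0 < 1 - x by lra.
have d1 : is_derive x 1 (fun t : R => 1 + t) 1.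
  have H := is_deriveD (is_derive_cst (1 : R) x (1 : R)) (is_derive_id x (1 : R)).
  by apply: is_derive_eq H _; rewrite add0r.
have d2 : is_derive x 1 (fun t : R => 1 - t) (- 1).
  have H := is_deriveB (is_derive_cst (1 : R) x (1 : R)) (is_derive_id x (1 : R)).
  by apply: is_derive_eq H _; rewrite add0r.
have l1 := @is_derive1_comp _ (@ln R) (fun t => 1 + t) x _ 1 (is_derive1_ln p1) d1.
have l2 := @is_derive1_comp _ (@ln R) (fun t => 1 - t) x _ (- 1) (is_derive1_ln p2) d2.
have H := is_deriveM (is_deriveB l1 l2) (is_derive_cst (2^-1 : R) x (1 : R)).
apply: is_derive_eq H _; rewrite /GRing.scale/= /cst mulr0 add0r.
have e : 1 + - 1 * x ^+ 2 = (1 - x) * (1 + x) by ring.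
by rewrite e; field; rewrite !gt_eqF.
Qed.

Lemma artanh0 : artanh 0 = 0.
Proof. by rewrite /artanh addr0 subr0 subrr mul0r. Qed.

Lemma artanh_tanh (y : R) :
  artanh ((expR y - expR (- y)) / (expR y + expR (- y))) = y.
Proof.
have p1 := expR_gt0 y; have p2 := expR_gt0 (- y).
have s0 : 0 < expR y + expR (- y) by rewrite addr_gt0.
set t := _ / _.
have e1 : 1 + t = 2 * expR y / (expR y + expR (- y)) by rewrite /t; field; rewrite gt_eqF.
have e2 : 1 - t = 2 * expR (- y) / (expR y + expR (- y)) by rewrite /t; field; rewrite gt_eqF.
rewrite /artanh e1 e2 !ln_div ?posrE ?mulr_gt0// !lnM ?posrE// !expRK.
by field.
Qed.

Lemma artanh_mul_surj (L : R) : 0 < L -> exists2 x, admissible (- 1) x & x * artanh x = L.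
Proof.
move=> L0.
pose y := L + 1; have y0 : 0 < y by rewrite addr_gt0.
have p1 := expR_gt0 y; have p2 := expR_gt0 (- y).
pose b := (expR y - expR (- y)) / (expR y + expR (- y)).
have s0 : 0 < expR y + expR (- y) by rewrite addr_gt0.
have b1 : b < 1 by rewrite ltr_pdivrMr// mul1r; lra.
have b0 : 0 < b.
  rewrite divr_gt0// subr_gt0 ltr_expR; lra.
(* With b = tanh y, the bound e ^ y >= 1 + y gives (1 - b) y <= 1, and then
   b y >= y - 1 = L. *)
have bL : L <= b * artanh b.
  rewrite artanh_tanh.
  have e1 : 1 + y <= expR y by exact: expR_ge1Dx.
  have e2 : expR (- y) * expR y = 1 by rewrite -expRD addNr expR0.
  have hb : 1 - b = 2 * expR (- y) / (expR y + expR (- y)) by rewrite /b; field; rewrite gt_eqF.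
  suff : (1 - b) * y <= 1 by rewrite /y mulrBl mul1r; lra.
  rewrite hb mulrAC ler_pdivrMr// mul1r.
  have e3 : 2 * y <= expR y * expR y + 1.
    have : (1 + y) * (1 + y) <= expR y * expR y by apply: ler_pM => //; lra.
    by have := sqr_ge0 y; rewrite expr2; lra.
  have : 2 * y * expR (- y) <= (expR y * expR y + 1) * expR (- y) by rewrite ler_pM2r.
  have -> : (expR y * expR y + 1) * expR (- y) = expR y * (expR (- y) * expR y) + expR (- y) by ring.
  by rewrite e2 mulr1 mulrAC.
have [||c] := @IVT R (fun x => x * artanh x) 0 b L (ltW b0).
- apply: continuous_in_subspaceT => x /set_mem; rewrite /= in_itv/= => /andP[x0 xb].
  apply: cont_ptM; first exact: cvg_id.
  apply: derive_continuous (is_derive_artanh x0 _).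
  by rewrite mulN1r subr_gt0 -(expr1n _ 2) ltr_sqr ?nnegrE// (le_lt_trans xb).
- by rewrite artanh0 mulr0 ge_min le_max (ltW L0) bL orbT.
rewrite in_itv/= => /andP[c0 cb] cL; exists c => //.
have cp : 0 < c by rewrite lt0r c0 andbT; apply: contraTneq L0 => c00; rewrite -cL c00 mul0r ltxx.
by apply/admissibleN1; rewrite cp (le_lt_trans cb).
Qed.

(** The mode is the hyperbolic cosine of rate [- alpha / x] centred at the midpoint
    of the interval, and [x = tanh (k l / 2)] expresses the boundary condition. *)
Lemma negative_spectrum (alpha : R) : alpha < 0 ->
  exists Lam, interval_spectrum (- 1) alpha Lam.
Proof.
move=> a0; apply: (@interval_spectrum_exists (- 1) alpha artanh).
- by rewrite mulrNN mulr1.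
- by rewrite mulN1r oppr_gt0.
- exact: artanh0.
- exact: is_derive_artanh.
- exact: artanh_mul_surj.
move=> x l /admissibleN1/andP[x0 x1] xl.
pose k := - alpha / x; pose c := l / 2.
have k0 : 0 < k by rewrite divr_gt0// oppr_gt0.
have kc : k * c = artanh x.
  apply: (mulfI (lt0r_neq0 x0)); rewrite xl /k /c; field; exact: lt0r_neq0.
pose ch (z : R) := expR z + expR (- z); pose sh (z : R) := expR z - expR (- z).
have dN (z : R) : is_derive z 1 (fun z : R => expR (- z)) (- expR (- z)).
  have H := @is_derive1_comp _ (@expR R) (-%R) z _ _ (is_derive_expR (- z)) (is_deriveNid z (1 : R)).
  by apply: is_derive_eq H _; rewrite mulrN1.
have dch (z : R) : is_derive z 1 ch (sh z) by exact: (is_deriveD (is_derive_expR z) (dN z)).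
have dsh (z : R) : is_derive z 1 sh (ch z).
  have H := is_deriveB (is_derive_expR z) (dN z).
  by apply: is_derive_eq H _; rewrite opprK.
have tE : k * sh (artanh x) = - alpha * ch (artanh x).
  by rewrite /sh tanh_pair ?ltW// mulrA /k divfK// lt0r_neq0.
exists (fun s => ch (k * (s - c))), (fun s => k * sh (k * (s - c))); split.
- by move=> s; apply: is_derive_affine.
- move=> s; have H := is_deriveZ k (is_derive_affine (dsh (k * (s - c)))).
  by apply: is_derive_eq H _; rewrite /GRing.scale/= /k; field; exact: lt0r_neq0.
- by move=> s _; rewrite addr_gt0// expR_gt0.
- rewrite sub0r mulrN kc; rewrite /sh /ch opprK in tE *; lra.
- have -> : l - c = c by rewrite /c; field.
  by rewrite kc tE.
Qed.

End interval_spectrum.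

(** * Comparison of boxes of equal volume *)

Section box_volumes.
Context {R : realType}.

Lemma edge_gt0 n (B : box R n) i : 0 < edge B i.
Proof. by rewrite subr_gt0; exact: box_lo_lt_hi. Qed.

Lemma volume_ln n (B : box R n) (V : R) : volume B = V%:E ->
  \sum_i ln (edge B i) = ln V.
Proof.
rewrite volumeE => -[<-].
suff [] : 0 < \prod_i edge B i /\ \sum_i ln (edge B i) = ln (\prod_i edge B i) by [].
elim/big_rec2: _ => [|i x y _ [y0 ->]]; first by rewrite ln1.
by rewrite mulr_gt0 ?edge_gt0// lnM ?posrE ?edge_gt0.
Qed.

Lemma cube_of_volume n (B : box R n.+1) : exists C : box R n.+1, is_cube C /\ volume C = volume B.
Proof.
pose l := expR (n.+1%:R^-1 * \sum_i ln (edge B i)).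
have orth : (1%:M : 'M[R]_n.+1) *m (1%:M)^T = 1%:M by rewrite trmx1 mulmx1.
have lt (i : 'I_n.+1) : (0 : 'rV[R]_n.+1) ord0 i < (const_mx l : 'rV[R]_n.+1) ord0 i.
  by rewrite !mxE expR_gt0.
pose C := Box orth (det1 R n.+1) lt.
have edgeC i : edge C i = l by rewrite /edge !mxE subr0.
exists C; split; first by move=> i j; rewrite !edgeC.
rewrite !volumeE; congr EFin.
rewrite (eq_bigr (fun=> l)); last by move=> i _; exact: edgeC.
rewrite prodr_const card_ord /l -expRM_natl mulrA divff ?pnatr_eq0// mul1r.
have -> : \prod_i edge B i = \prod_i expR (ln (edge B i)).
  by apply: eq_bigr => i _; rewrite lnK// posrE edge_gt0.
by rewrite (big_morph _ (@expRD R) (expR0 R)).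
Qed.

End box_volumes.

Section box_comparison.
Context {R : realType} (m : nat) (sigma alpha : R) (Lam : R -> R).
Context (spec : interval_spectrum sigma alpha Lam).
Implicit Types B : box R m.+1.

Lemma lambda1_sum B : lambda1 B alpha = \sum_i Lam (edge B i).
Proof.
have [modes _ _] := spec.
have /choice[phi /choice[dphi H]] : forall i, exists phi dphi,
  robin_mode alpha (edge B i) (Lam (edge B i)) phi dphi by move=> i; exact/modes/edge_gt0.
exact: lambda1_box H.
Qed.

Lemma lambda1_sign B : 0 < sigma * lambda1 B alpha.
Proof.
have [_ pos _] := spec.
rewrite lambda1_sum mulr_sumr (bigD1 ord0)//= ltr_pwDl ?pos ?edge_gt0//.
by rewrite sumr_ge0// => i _; rewrite ltW// pos ?edge_gt0.
Qed.

(** Tangent line inequality at the edge of the cube, for each edge of [B']: the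
    linear terms add up to a multiple of the difference of the logarithms of the two
    volumes, which is 0. *)
Lemma cube_strict_min B B' (V : R) : volume B = V%:E -> volume B' = V%:E ->
  is_cube B ->
  sigma * lambda1 B alpha <= sigma * lambda1 B' alpha /\
  (~ is_cube B' -> sigma * lambda1 B alpha < sigma * lambda1 B' alpha).
Proof.
move=> BV B'V cubeB; have [_ _ tangent] := spec.
pose l0 := edge B ord0.
have [c Hc] := tangent l0 (edge_gt0 B ord0).
have Hle i : sigma * Lam l0 - c * (ln (edge B' i) - ln l0) <= sigma * Lam (edge B' i).
  have [->|ne] := eqVneq (edge B' i) l0; first by rewrite subrr mulr0 subr0.
  by rewrite ltW// Hc// edge_gt0.
have E : sigma * lambda1 B alpha =
    \sum_i (sigma * Lam l0 - c * (ln (edge B' i) - ln l0)).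
  rewrite sumrB -[X in _ - X]mulr_sumr sumrB (volume_ln B'V) -(volume_ln BV) lambda1_sum mulr_sumr.
  have -> : \sum_i ln (edge B i) = \sum_(i < m.+1) ln l0.
    by apply: eq_bigr => i _; rewrite (cubeB i ord0).
  by rewrite subrr mulr0 subr0; apply: eq_bigr => i _; rewrite (cubeB i ord0).
rewrite E (lambda1_sum B') mulr_sumr; split; first exact: ler_sum.
move=> ncube.
have [i ne] : exists i, edge B' i != l0.
  apply/not_existsP => H; apply: ncube => i j.
  by have /negP/negPn/eqP -> := H i; have /negP/negPn/eqP -> := H j.
rewrite (bigD1 i)//= [ltRHS](bigD1 i)//= ltr_leD//; first by rewrite Hc// edge_gt0.
exact: ler_sum.
Qed.

(** A minimizer that is not a cube would be strictly improved by the cube of the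
    same volume. *)
Lemma minimal_iff_cube B (V : R) : volume B = V%:E ->
  (forall B', volume B' = V%:E -> sigma * lambda1 B alpha <= sigma * lambda1 B' alpha) <->
  is_cube B.
Proof.
move=> BV; split=> [minB|cubeB B' B'V]; last by have [] := cube_strict_min BV B'V cubeB.
have [C [cubeC CV]] := cube_of_volume B; rewrite BV in CV.
apply: contrapT => ncube.
have [_ /(_ ncube)] := cube_strict_min CV BV cubeC.
by rewrite ltNge minB.
Qed.

End box_comparison.

Theorem theorem3p1 (R : realType) (n : nat) (n_gt0 : (0 < n)%N) (alpha : R) :
  (0 < alpha ->
     (forall B : box R n, 0 < lambda1 B alpha) /\
     (forall (V : R) (B : box R n), volume B = V%:E ->
        ((forall B' : box R n, volume B' = V%:E ->
            lambda1 B alpha <= lambda1 B' alpha) <-> is_cube B))) /\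
  (alpha < 0 ->
     (forall B : box R n, lambda1 B alpha < 0) /\
     (forall (V : R) (B : box R n), volume B = V%:E ->
        ((forall B' : box R n, volume B' = V%:E ->
            lambda1 B' alpha <= lambda1 B alpha) <-> is_cube B))).
Proof.
case: n n_gt0 => // m _; split=> alpha0.
  have [Lam spec] := positive_spectrum alpha0.
  split=> [B|V B BV]; first by have := lambda1_sign spec B; rewrite mul1r.
  rewrite -(minimal_iff_cube spec BV).
  by split=> H B' B'V; have := H B' B'V; rewrite !mul1r.
have [Lam spec] := negative_spectrum alpha0.
split=> [B|V B BV]; first by have := lambda1_sign spec B; rewrite mulN1r oppr_gt0.
rewrite -(minimal_iff_cube spec BV).
by split=> H B' B'V; have := H B' B'V; rewrite !mulN1r lerN2.
Qed.
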